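(* Let $X_1,X_2,\dots$ be independent identically distributed random variables and $S_n=X_1+\dots+X_n$. Let $\{\tau_n\}_{n\ge1}$ be a nonnegative sequence and let $\{a_n\}_{n\ge1}$ be a non-decreasing strictly positive sequence with $a_n\to\infty$. Suppose there exist finite real constants $\theta\ge1$, $C>0$ and $N\ge2$ such that for all $n\ge N$, $$\frac{a_n^{3\theta}}{n^{\theta-1}}\sum_{k=n}^\infty \frac{k^\theta\tau_k}{a_k^{3\theta}}\le C\sum_{k=1}^{n-1}k\tau_k.$$ If $\theta>1$, assume additionally that $$\liminf_{n\to\infty}\inf_{k\ge n}\frac{a_k^3}{k a_n^3}\sum_{j=1}^{n-1} j\tau_j>0.$$ Consider the conditions: (i) there is a sequence $\{\mu_n\}$ with $\mu_n$ a median of $S_n$ for every $n$, such that for every $\varepsilon>0$, $\sum_{n\in M_\varepsilon}\tau_n<\infty$, where $M_\varepsilon=\{n\in\mathbb Z^+: |\mu_n|>\varepsilon a_n\}$; (ii) $\sum_{n=1}^\infty n\tau_n P(|X_1|\ge \varepsilon a_n)<\infty$ for all $\varepsilon>0$; (iii) $\sum_{n=1}^\infty \tau_n e^{-\varepsilon^2a_n^2/(nT_{\varepsilon,n})}<\infty$ for all $\varepsilon>0$, where $T_{\varepsilon,n}=E[X_1^2 1_{\{|X_1|<\varepsilon a_n\}}]$ and $e^{-t/0}=0$ for $t>0$. If (i), (ii) and (iii) all hold, then $$\sum_{n=1}^\infty \tau_nP(|S_n|\ge\varepsilon a_n)<\infty\quad\text{for all }\varepsilon>0. \qquad ( * )$$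 Conversely, if $\{\tau_n\}$ satisfies Condition A and $( * )$ holds, then (i), (ii) and (iii) all hold.
   Context: ''Positive'' means nonnegative; ''increasing'' means non-decreasing. A nonnegative sequence $\{\tau_n\}_{n\ge1}$ satisfies Condition A if for every nonnegative non-increasing sequence $\{c_n\}$ with $\sum_n \tau_n\min(nc_n,1)<\infty$ we also have $\sum_n\tau_n nc_n<\infty$. *)

(* Defs.v *)
From HB Require Import structures.
From mathcomp Require Import all_boot all_order all_algebra.
From mathcomp Require Import all_classical all_reals all_analysis.
Set Implicit Arguments. Unset Strict Implicit. Unset Printing Implicit Defensive.
Import Order.TTheory GRing.Theory Num.Theory.
Import numFieldNormedType.Exports.
Local Open Scope classical_set_scope.
Local Open Scope ring_scope.

Section defs.
Context {d : measure_display} {T : measurableType d} {R : realType}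
  (P : probability T R).

Definition mutually_independent (X : nat -> {RV P >-> R}) : Prop :=
  forall (s : seq nat), uniq s -> forall B : nat -> set R,
    (forall i, measurable (B i)) ->
    P (\big[setI/setT]_(i <- s) (X i @^-1` B i)) =
    (\prod_(i <- s) P (X i @^-1` B i))%E.

Definition identically_distributed (X : nat -> {RV P >-> R}) : Prop :=
  forall i (B : set R), measurable B -> P (X i @^-1` B) = P (X 0%N @^-1` B).

Definition iid (X : nat -> {RV P >-> R}) : Prop :=
  mutually_independent X /\ identically_distributed X.

(* S n = X_1 + ... + X_n, with X_1 := X 0, ..., X_n := X (n-1) *)
Definition partial_sum (X : nat -> {RV P >-> R}) (n : nat) : T -> R :=
  fun w => \sum_(i < n) X i w.

Definition is_median (Y : T -> R) (m : R) : Prop :=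
  ((1/2)%:E <= P [set w | (m <= Y w)%R])%E /\ ((1/2)%:E <= P [set w | (Y w <= m)%R])%E.

(* T_{eps,n} = E[X_1^2 1_{|X_1| < eps a_n}] (always finite) *)
Definition trunc_second_moment (X : nat -> {RV P >-> R}) (a : nat -> R)
  (eps : R) (n : nat) : R :=
  let f : T -> R := fun w =>
    (X 0%N w) ^+ 2 * (if `|X 0%N w| < eps * a n then 1 else 0) in
  fine ('E_P[f])%E.

(* e^{-eps^2 a_n^2 / (n T_{eps,n})}, with the convention e^{-t/0} = 0 (t > 0) *)
Definition exp_term (X : nat -> {RV P >-> R}) (a : nat -> R) (eps : R)
  (n : nat) : R :=
  let Tn := trunc_second_moment X a eps n in
  if Tn == 0 then 0 else expR (- (eps ^+ 2 * a n ^+ 2) / (n%:R * Tn)).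

End defs.

Definition conditionA {R : realType} (tau : nat -> R) : Prop :=
  forall c : nat -> R,
    (forall n, (1 <= n)%N -> 0 <= c n) ->
    (forall n, (1 <= n)%N -> c n.+1 <= c n) ->
    (\sum_(1 <= n <oo) (tau n * Num.min (n%:R * c n) 1)%:E < +oo)%E ->
    (\sum_(1 <= n <oo) (tau n * (n%:R * c n))%:E < +oo)%E.

(* Main.v *)
(** Write X' for X_1 truncated at b = eps a_n, T and beta for its second and third
    absolute moments.

    Upper bound: e^v <= 1 + v + v^2 + 27 |v|^3 e^w for |v| <= w, so Markov's inequality
    for e^{hS'_n}, with h chosen as in the Fuk-Nagaev inequality, bounds the tail of the
    centered truncated sum at level 4 theta b by a multiple of
    e^{-b^2/(nT)} + (n beta/b^3)^theta; the median of S_n controls the centering.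

    Lower bound: split S'_n into k blocks with k of order a_n^2/(nT).  If the fourth
    moment of X' is small enough, each block exceeds its standard deviation over 100 with
    probability at least 1/1600, whence P(|S'_n| >= lambda a_n) >= c e^{-eps^2 a_n^2/(nT)};
    otherwise e^{-eps^2 a_n^2/(nT)} is itself at most a multiple of (n beta/a_n^3)^theta.

    The hypotheses on tau and a enter only through summation by parts, which shows that
    (ii) makes the series of tau_n (n beta/a_n^3)^theta converge.  Condition (ii) follows
    from the lower bound min(n p, 1) <= 64 P(|S_n| >= t/2), p = P(|X_1| >= 2t), and
    Condition A. *)

Require Import Defs.
From HB Require Import structures.
From mathcomp Require Import all_boot all_order all_algebra.
From mathcomp Require Import all_classical all_reals all_analysis.
From mathcomp Require Import measurable_realfun.
From mathcomp Require Import ring lra zify.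
Import Order.TTheory GRing.Theory Num.Theory.
Import numFieldNormedType.Exports.
Set Implicit Arguments. Unset Strict Implicit. Unset Printing Implicit Defensive.
Local Open Scope classical_set_scope.
Local Open Scope ring_scope.

(** * Bounded random variables and their expectations *)

(** Every condition is imposed for all eps > 0, so each pointwise estimate may change the threshold
    by a constant factor: 8 theta + 1 in one direction, 6000 in the other. Constants can therefore
    be crude. The lower bound must survive when it is exponentially small. With k the integer part
    of eps^2 a_n^2/(1600 n T), the cost 1600^(-k-1) of k + 1 independent blocks is comparable to the
    exponential, while their deviations still add up to order eps a_n. A block of m variables is
    controlled only if E X'^4 <= m T^2; where this fails, the third moment is so large that the
    power term takes over. Blocks are not centered: a nonnegative mean, reached by a change of sign,
    only helps once sums are normalized by their second moment instead of their variance. In the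
    converse (ii) has to precede (iii), because truncation costs n P(|X_1| >= eps a_n). What ties
    (ii) to beta is an increment bound: between two truncation levels beta grows by at most the cube
    of the larger one times the loss of tail probability. *)

Section level_sets.
Context {d : measure_display} {T : measurableType d} {R : realType}.
Implicit Types (f g : T -> R).

Lemma measurable_set_le f g : measurable_fun setT f -> measurable_fun setT g ->
  measurable [set x | f x <= g x].
Proof.
move=> mf mg; have := measurable_fun_ler mf mg measurableT (Y := [set true]) I.
by rewrite setTI.
Qed.

Lemma measurable_set_lt f g : measurable_fun setT f -> measurable_fun setT g ->
  measurable [set x | f x < g x].
Proof.
move=> mf mg; have := measurable_fun_ltr mf mg measurableT (Y := [set true]) I.
by rewrite setTI.
Qed.

Lemma measurable_norm_ge f (c : R) : measurable_fun setT f ->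
  measurable [set x | c <= `|f x|].
Proof. by move=> mf; apply: measurable_set_le => //; exact: measurableT_comp. Qed.

Lemma measurable_norm_lt f (c : R) : measurable_fun setT f ->
  measurable [set x | `|f x| < c].
Proof. by move=> mf; apply: measurable_set_lt => //; exact: measurableT_comp. Qed.

End level_sets.

Section bounded_expectation.
Context {d : measure_display} {T : measurableType d} {R : realType}
  (P : probability T R).
Implicit Types (f g : T -> R) (c : R) (A : set T).

(** All expectations below are of truncated variables, indicators and functions of them. On this
    class [EV] is linear and monotone, so integrability need not be carried along. *)
Definition bounded_measurable f : Prop :=
  measurable_fun setT f /\ exists M : R, forall x, `|f x| <= M.
Notation bm := bounded_measurable.

Definition EV f : R := \int[P]_x f x.

Definition Pr A : R := fine (P A).

Lemma bm_ext f g : f =1 g -> bm f -> bm g.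
Proof. by move=> /funext ->. Qed.

Lemma bm_integrable f : bm f -> P.-integrable setT (EFin \o f).
Proof.
move=> [mf [M fM]]; apply: measurable_bounded_integrable => //.
- exact: (le_lt_trans (probability_le1 P measurableT) (ltry 1)).
- exists M; split; first exact: num_real.
  by move=> x Mx y _; exact: le_trans (fM y) (ltW Mx).
Qed.

Lemma bm_cst c : bm (fun=> c).
Proof. by split; [exact: measurable_cst | exists `|c|]. Qed.

Lemma bm_add f g : bm f -> bm g -> bm (fun x => f x + g x).
Proof.
move=> [mf [M fM]] [mg [N gN]]; split; first exact: measurable_funD.
by exists (M + N) => x; rewrite (le_trans (ler_normD _ _)) ?lerD.
Qed.

Lemma bm_mul f g : bm f -> bm g -> bm (fun x => f x * g x).
Proof.
move=> [mf [M fM]] [mg [N gN]]; split; first exact: measurable_funM.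
by exists (M * N) => x; rewrite normrM ler_pM.
Qed.

Lemma bm_scale c f : bm f -> bm (fun x => c * f x).
Proof. by move=> bf; apply: bm_mul => //; exact: bm_cst. Qed.

Lemma bm_opp f : bm f -> bm (fun x => - f x).
Proof.
by move=> bf; apply: (@bm_ext (fun x => -1 * f x)) (bm_scale _ bf) => x; rewrite mulN1r.
Qed.

Lemma bm_sub f g : bm f -> bm g -> bm (fun x => f x - g x).
Proof. by move=> bf bg; apply: bm_add => //; exact: bm_opp. Qed.

Lemma bm_exp f n : bm f -> bm (fun x => f x ^+ n).
Proof.
move=> bf; elim: n => [|n IH].
  by apply: (@bm_ext (fun=> 1)) (bm_cst _).
by apply: (@bm_ext (fun x => f x * f x ^+ n)) (bm_mul bf IH) => x; rewrite exprS.
Qed.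

Lemma bm_norm f : bm f -> bm (fun x => `|f x|).
Proof.
move=> [mf [M fM]]; split; first exact: measurableT_comp.
by exists M => x; rewrite normr_id.
Qed.

Lemma bm_expR f : bm f -> bm (fun x => expR (f x)).
Proof.
move=> [mf [M fM]]; split; first exact: measurableT_comp.
by exists (expR M) => x; rewrite ger0_norm ?expR_ge0// ler_expR (le_trans (ler_norm _)).
Qed.

Lemma bm_sum (I : Type) (s : seq I) (F : I -> T -> R) :
  (forall i, bm (F i)) -> bm (fun x => \sum_(i <- s) F i x).
Proof.
move=> bF; elim: s => [|i s IH].
  by apply: (@bm_ext (fun=> 0)) (bm_cst _) => x; rewrite big_nil.
by apply: (@bm_ext (fun x => F i x + \sum_(i <- s) F i x)) (bm_add (bF i) IH) => x;
  rewrite big_cons.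
Qed.

Lemma bm_indic A : measurable A -> bm (\1_A : T -> R).
Proof.
move=> mA; split; first exact: measurable_indic.
by exists 1 => x; rewrite indicE; case: (x \in A); rewrite ?normr1 ?normr0.
Qed.

Lemma EV_cst c : EV (fun=> c) = c.
Proof.
rewrite /EV Rintegral_cst// -[RHS]mulr1; congr (_ * _).
exact: (congr1 fine (probability_setT P)).
Qed.

Lemma EV_add f g : bm f -> bm g -> EV (fun x => f x + g x) = EV f + EV g.
Proof. by move=> bf bg; rewrite /EV RintegralD//; exact: bm_integrable. Qed.

Lemma EV_sub f g : bm f -> bm g -> EV (fun x => f x - g x) = EV f - EV g.
Proof. by move=> bf bg; rewrite /EV RintegralB//; exact: bm_integrable. Qed.

Lemma EV_scale c f : bm f -> EV (fun x => c * f x) = c * EV f.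
Proof. by move=> bf; rewrite /EV RintegralZl//; exact: bm_integrable. Qed.

Lemma EV_opp f : bm f -> EV (fun x => - f x) = - EV f.
Proof.
move=> bf; rewrite -mulN1r -EV_scale//; congr EV.
by apply/funext => x; rewrite mulN1r.
Qed.

Lemma EV_le f g : bm f -> bm g -> (forall x, f x <= g x) -> EV f <= EV g.
Proof. by move=> bf bg fg; apply: le_Rintegral => //; exact: bm_integrable. Qed.

Lemma EV_ge0 f : (forall x, 0 <= f x) -> 0 <= EV f.
Proof. by move=> f0; apply: Rintegral_ge0. Qed.

Lemma EV_sum (I : Type) (s : seq I) (F : I -> T -> R) :
  (forall i, bm (F i)) -> EV (fun x => \sum_(i <- s) F i x) = \sum_(i <- s) EV (F i).
Proof.
move=> bF; elim: s => [|i s IH].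
  by rewrite big_nil -[RHS](EV_cst 0); congr EV; apply/funext => x; rewrite big_nil.
rewrite big_cons -IH -EV_add//; last exact: bm_sum.
by congr EV; apply/funext => x; rewrite big_cons.
Qed.

Lemma PrE A : measurable A -> P A = (Pr A)%:E.
Proof. by move=> mA; rewrite /Pr fineK// fin_num_measure. Qed.

Lemma EV_indic A : measurable A -> EV \1_A = Pr A.
Proof. by move=> mA; rewrite /EV /Rintegral integral_indic// setIT. Qed.

Lemma Pr_ge0 A : 0 <= Pr A.
Proof. by rewrite /Pr fine_ge0. Qed.

Lemma Pr_le1 A : measurable A -> Pr A <= 1.
Proof. by move=> mA; rewrite -lee_fin -PrE// probability_le1. Qed.

Lemma le_Pr A B : measurable A -> measurable B -> A `<=` B -> Pr A <= Pr B.
Proof. by move=> mA mB AB; rewrite -lee_fin -!PrE//; apply: le_measure; rewrite ?inE. Qed.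

Lemma Pr_setC A : measurable A -> Pr (~` A) = 1 - Pr A.
Proof.
move=> mA; apply: EFin_inj; rewrite -PrE; last exact: measurableC.
by rewrite probability_setC// PrE.
Qed.

Lemma Pr_setU A B : measurable A -> measurable B -> Pr (A `|` B) <= Pr A + Pr B.
Proof.
move=> mA mB; rewrite -lee_fin EFinD -!PrE//; last exact: measurableU.
exact: measureU2.
Qed.

Lemma Pr_markov f A c : bm f -> measurable A -> (forall x, 0 <= f x) ->
  (forall x, A x -> c <= f x) -> c * Pr A <= EV f.
Proof.
move=> bf mA f0 Af; rewrite -EV_indic// -EV_scale; last exact: bm_indic.
apply: EV_le => //; first exact/bm_scale/bm_indic.
move=> x; rewrite indicE; case: (boolP (x \in A)) => [/set_mem/Af|_].
  by rewrite mulr1.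
by rewrite mulr0.
Qed.

End bounded_expectation.
Notation bm := bounded_measurable.

Ltac bmt := lazymatch goal with
  | |- bounded_measurable (fun x => @?f x - @?g x) => apply: (@bm_sub _ _ _ f g); bmt
  | |- bounded_measurable (fun x => @?f x + @?g x) => apply: (@bm_add _ _ _ f g); bmt
  | |- bounded_measurable (fun x => - @?f x) => apply: (@bm_opp _ _ _ f); bmt
  | |- bounded_measurable (fun x => @?f x * @?g x) => apply: (@bm_mul _ _ _ f g); bmt
  | |- bounded_measurable (fun x => @?f x ^+ ?n) => apply: (@bm_exp _ _ _ f n); bmt
  | |- bounded_measurable (fun x => `|@?f x|) => apply: (@bm_norm _ _ _ f); bmt
  | |- bounded_measurable (fun x => expR (@?f x)) => apply: (@bm_expR _ _ _ f); bmt
  | |- _ => solve [exact: bm_cst | assumption | match goal with H : _ |- _ => exact: H end]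
  end.

(** * Expectation of a product of independent bounded variables *)

Section independence.
Context {d : measure_display} {T : measurableType d} {R : realType}
  (P : probability T R).

Definition indep2 (U V : T -> R) := forall A B : set R, measurable A -> measurable B ->
  P (U @^-1` A `&` V @^-1` B) = (P (U @^-1` A) * P (V @^-1` B))%E.

Lemma indep2_shift (U V : T -> R) (b c : R) : indep2 U V ->
  indep2 (fun x => U x + b) (fun x => V x + c).
Proof.
move=> UV A B mA mB.
have ms (e : R) : measurable_fun setT (fun x : R => x + e).
  by apply: measurable_funD.
have := UV ((fun x => x + b) @^-1` A) ((fun x => x + c) @^-1` B).
apply; rewrite -[X in measurable X]setTI; exact: ms.
Qed.

(** The law of the pair agrees with the product of the marginal laws on rectangles, hence
    everywhere, and Tonelli's theorem splits the integral. *)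
Let EV_indep_ge0 (U V : T -> R) : bm U -> bm V -> indep2 U V ->
  (forall x, 0 <= U x) -> (forall x, 0 <= V x) ->
  EV P (fun x => U x * V x) = EV P U * EV P V.
Proof.
move=> bU bV UV U0 V0.
have mU : measurable_fun setT U by case: bU.
have mV : measurable_fun setT V by case: bV.
pose U' : {mfun T >-> R} := MeasurableFun.Pack (MeasurableFun.Class (isMeasurableFun.Build _ _ _ _ U mU)).
pose V' : {mfun T >-> R} := MeasurableFun.Pack (MeasurableFun.Class (isMeasurableFun.Build _ _ _ _ V mV)).
have mW : measurable_fun setT (fun x => (U x, V x)) by apply: measurable_fun_pair.
pose W' : {mfun T >-> (R * R)%type} := MeasurableFun.Pack (MeasurableFun.Class (isMeasurableFun.Build _ _ _ _ (fun x => (U x, V x)) mW)).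
have E : forall X, measurable X ->
  ((distribution P U' : {measure set R -> \bar R}) \x (distribution P V' : {measure set R -> \bar R}))%E X = distribution P W' X.
  apply: product_measure_unique => A B mA mB.
  exact: (UV A B mA mB).
(* Absolute values make the integrand nonnegative on the whole plane, as Tonelli requires; on the
   range of the pair they change nothing. *)
pose f (z : R * R) : \bar R := (`|z.1| * `|z.2|)%:E.
have mf : measurable_fun setT f.
  by apply/measurable_EFinP/measurable_funM; apply: measurableT_comp.
have f0 z : (0 <= f z)%E by rewrite lee_fin mulr_ge0.
have E1 : (\int[P]_x (U x * V x)%:E = \int[distribution P W']_z f z)%E.
  rewrite ge0_integral_distribution//; apply: eq_integral => x _ /=.
  by rewrite /f /= !ger0_norm.
have E2 : (\int[distribution P W']_z f z = \int[distribution P U']_x \int[distribution P V']_y f (x, y))%E.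
  rewrite -fubini_tonelli1//; apply/esym/eq_measure_integral => A mA _.
  exact: E.
have mabs : measurable_fun setT (fun y : R => `|y|%:E : \bar R).
  by apply/measurable_EFinP; exact: normr_measurable.
have IE (V0' : {mfun T >-> R}) : bm V0' -> (forall x, 0 <= V0' x) ->
    (\int[distribution P V0']_y `|y|%:E = (EV P V0')%:E)%E.
  move=> bV0 V00; rewrite ge0_integral_distribution//.
  rewrite /EV /Rintegral fineK.
    by apply: eq_integral => x _ /=; rewrite ger0_norm.
  by apply: integrable_fin_num => //; exact: bm_integrable.
rewrite {1}/EV /Rintegral E1 E2.
transitivity (fine (\int[distribution P U']_x (`|x|%:E * (EV P V)%:E))%E).
  congr fine; apply: eq_integral => x _.
  rewrite -(IE V' bV V0) -ge0_integralZl//.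
rewrite ge0_integralZr//.
  by rewrite (IE U' bU U0).
by rewrite lee_fin; apply: EV_ge0.
Qed.

(** Adding the bounds [M] and [N] makes both factors nonnegative and keeps them independent;
    expanding the product removes the shift. *)
Lemma EV_indep (U V : T -> R) : bm U -> bm V -> indep2 U V ->
  EV P (fun x => U x * V x) = EV P U * EV P V.
Proof.
move=> bU bV UV.
have [mU [M UM]] := bU; have [mV [N VN]] := bV.
have U0 x : 0 <= U x + M by have := UM x; rewrite ler_norml; lra.
have V0 x : 0 <= V x + N by have := VN x; rewrite ler_norml; lra.
have bU' : bm (fun x => U x + M) by apply: bm_add => //; exact: bm_cst.
have bV' : bm (fun x => V x + N) by apply: bm_add => //; exact: bm_cst.
have := EV_indep_ge0 bU' bV' (indep2_shift M N UV) U0 V0.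
rewrite !(@EV_add _ _ _ P _ (fun=> _))//; try exact: bm_cst.
rewrite !EV_cst.
have -> : EV P (fun x => (U x + M) * (V x + N)) =
  EV P (fun x => U x * V x + (N * U x + (M * V x + M * N))).
  by congr EV; apply/funext => x; ring.
have bc c := @bm_cst _ T R c.
rewrite EV_add; [|exact: bm_mul|by do ?[exact: bc|exact: bm_scale|apply: bm_add]].
rewrite EV_add; [|exact: bm_scale|by do ?[exact: bc|exact: bm_scale|apply: bm_add]].
rewrite EV_add; [|exact: bm_scale|exact: bc].
rewrite !EV_scale// EV_cst; lra.
Qed.

End independence.

(** * Independence of sums over disjoint index sets *)

Section mutual_independence.
Context {d : measure_display} {T : measurableType d} {R : realType}
  (P : probability T R).
Implicit Types (X Y : nat -> {RV P >-> R}) (s : seq nat).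

Definition mkRV (f : T -> R) (mf : measurable_fun setT f) : {RV P >-> R} :=
  MeasurableFun.Pack (MeasurableFun.Class (isMeasurableFun.Build _ _ _ _ f mf)).

(** A pi-system generating the sigma-algebra of the variables with index in [s]. *)
Definition cylinders X s : set (set T) :=
  [set A | exists2 B : nat -> set R, (forall i, measurable (B i)) &
     A = \big[setI/setT]_(i <- s) (X i @^-1` B i)].

Lemma measurable_cylinder X s (B : nat -> set R) : (forall i, measurable (B i)) ->
  measurable (\big[setI/setT]_(i <- s) (X i @^-1` B i)).
Proof.
move=> mB; apply: bigsetI_measurable => i _.
by rewrite -[X in measurable X]setTI; exact: measurable_funPT.
Qed.

Lemma cylindersI X s : setI_closed (cylinders X s).
Proof.
move=> A B [B1 mB1 ->] [B2 mB2 ->]; exists (fun i => B1 i `&` B2 i).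
  by move=> i; exact: measurableI.
by rewrite -big_split /=; apply: eq_bigr => i _; rewrite preimage_setI.
Qed.

Lemma cylindersT X s : cylinders X s setT.
Proof.
by exists (fun=> setT) => //; rewrite big1// => i _; rewrite preimage_setT.
Qed.

Lemma cylinders_measurable X s A : <<s cylinders X s >> A -> measurable A.
Proof.
move=> sA; apply: (sA measurable); split; first exact: sigma_algebra_measurable.
by move=> B [B1 mB1 ->]; exact: measurable_cylinder.
Qed.

(** Dynkin's argument: both sides are finite measures in [A] and agree on a pi-system containing the
    whole space, so they agree on the sigma-algebra it generates. *)
Lemma Pr_product_extend (G : set (set T)) (B : set T) : setI_closed G -> G setT ->
  G `<=` measurable -> measurable B ->
  (forall A, G A -> Pr P (A `&` B) = Pr P A * Pr P B) ->
  forall A, <<s G >> A -> Pr P (A `&` B) = Pr P A * Pr P B.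
Proof.
move=> GI GT Gm mB GB A sA.
have mA : measurable A.
  by apply: (sA measurable); split; first exact: sigma_algebra_measurable.
have mAB : measurable (A `&` B) by exact: measurableI.
pose c := NngNum (Pr_ge0 P B).
have E : P (A `&` B) = ((Pr P B)%:E * P A)%E.
  apply: (@g_sigma_algebra_measure_unique _ R T G Gm (fun=> setT) (fun=> GT) _
    (mrestr P mB) (mscale c P) GI _ _ A sA).
  - by rewrite bigcup_const//; exists 0%N.
  - move=> C GC; have mC := Gm _ GC.
    suff : P (C `&` B) = ((Pr P B)%:E * P C)%E by [].
    by rewrite (PrE _ mC) (PrE _ (measurableI _ _ mC mB)) -EFinM GB// mulrC.
  - move=> _; suff : (P (setT `&` B) < +oo)%E by [].
    by rewrite PrE ?ltry//; apply: measurableI.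
by apply: EFin_inj; rewrite -PrE// E mulrC EFinM -(PrE _ mA).
Qed.

Lemma Pr_prod_cylinders X s (B : nat -> set R) : mutually_independent X -> uniq s ->
  (forall i, measurable (B i)) ->
  Pr P (\big[setI/setT]_(i <- s) (X i @^-1` B i)) = \prod_(i <- s) Pr P (X i @^-1` B i).
Proof.
move=> iX us mB; apply: EFin_inj; rewrite -PrE; last exact: measurable_cylinder.
rewrite iX// -prodEFin; apply: eq_bigr => i _; rewrite PrE//.
by rewrite -[X in measurable X]setTI; exact: measurable_funPT.
Qed.

(** [Pr_product_extend] is used once for each factor, which leaves two cylinders over disjoint index
    lists. *)
Lemma indep_sigma X s1 s2 A B : mutually_independent X -> uniq (s1 ++ s2) ->
  <<s cylinders X s1 >> A -> <<s cylinders X s2 >> B ->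
  Pr P (A `&` B) = Pr P A * Pr P B.
Proof.
move=> iX us sA sB; have mB := cylinders_measurable sB.
have Gm s : cylinders X s `<=` measurable.
  by move=> C [C1 mC1 ->]; exact: measurable_cylinder.
apply: (Pr_product_extend (@cylindersI X s1) (@cylindersT X s1) (Gm s1) mB _ sA).
move=> {sA}A GA; rewrite setIC mulrC.
apply: (Pr_product_extend (@cylindersI X s2) (@cylindersT X s2) (Gm s2) (Gm _ _ GA) _ sB).
move=> {sB mB}B [B2 mB2 ->]; case: GA => B1 mB1 ->.
(* One family of Borel sets for both lists, so that mutual independence over [s1 ++ s2] applies. *)
pose B3 i := if i \in s1 then B1 i else B2 i.
have mB3 i : measurable (B3 i) by rewrite /B3; case: ifP.
move: (us); rewrite cat_uniq => /and3P[us1 /hasPn s12 us2].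
have E1 : \big[setI/setT]_(i <- s1) (X i @^-1` B1 i) =
    \big[setI/setT]_(i <- s1) (X i @^-1` B3 i).
  by apply: eq_big_seq => i is1; rewrite /B3 is1.
have E2 : \big[setI/setT]_(i <- s2) (X i @^-1` B2 i) =
    \big[setI/setT]_(i <- s2) (X i @^-1` B3 i).
  by apply: eq_big_seq => i is2; rewrite /B3 (negbTE (s12 _ is2)).
by rewrite E1 E2 setIC -big_cat !Pr_prod_cylinders// big_cat mulrC.
Qed.

Definition depends_on X s (U : T -> R) :=
  forall B : set R, measurable B -> <<s cylinders X s >> (U @^-1` B).

Lemma indep2_depends_on X s1 s2 (U V : T -> R) : mutually_independent X ->
  uniq (s1 ++ s2) -> depends_on X s1 U -> depends_on X s2 V -> indep2 P U V.
Proof.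
move=> iX us DU DV A B mA mB.
have mU := cylinders_measurable (DU _ mA); have mV := cylinders_measurable (DV _ mB).
by rewrite !PrE//; [rewrite -EFinM (indep_sigma iX us (DU _ mA) (DV _ mB))|exact: measurableI].
Qed.

Lemma depends_on_sum X s : depends_on X s (fun x => \sum_(i <- s) X i x).
Proof.
(* On the sample space with the smaller sigma-algebra each [X i], [i] in [s], is still measurable,
   so the usual measurability of sums gives the claim. *)
pose TG : measurableType _ := g_sigma_algebraType (cylinders X s).
have mX i : i \in s -> @measurable_fun _ _ TG R setT (X i).
  move=> is_ _ B mB; rewrite setTI; apply: sub_sigma_algebra.
  exists (fun j => if j == i then B else setT); first by move=> j; case: ifP.
  rewrite (eq_big_seq (fun j => if j == i then X i @^-1` B else setT)); last first.
    by move=> j _; case: eqP => [->//|_]; rewrite preimage_setT.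
  apply/seteqP; split => [x XB|x].
    by elim/big_ind: _ => // j _; case: ifP.
  rewrite (perm_big _ (perm_to_rem is_)) big_cons eqxx; by case.
have mS : @measurable_fun _ _ TG R setT (fun x => \sum_(i <- s) X i x).
  have : forall s', {subset s' <= s} -> @measurable_fun _ _ TG R setT (fun x => \sum_(i <- s') X i x).
    elim=> [_|i s' IH ss].
      by under eq_fun do rewrite big_nil; exact: measurable_cst.
    under eq_fun do rewrite big_cons; apply: measurable_funD.
      by apply: mX; apply: ss; rewrite mem_head.
    by apply: IH => j js; apply: ss; rewrite in_cons js orbT.
  by apply.
by move=> B mB; have := mS measurableT B mB; rewrite setTI.
Qed.

Lemma indep_sum_cat X s1 s2 : mutually_independent X -> uniq (s1 ++ s2) ->
  indep2 P (fun x => \sum_(i <- s1) X i x) (fun x => \sum_(i <- s2) X i x).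
Proof. by move=> iX us; apply: (indep2_depends_on iX us) => //; exact: depends_on_sum. Qed.

Lemma indep_sum_cons X j s : mutually_independent X -> uniq (j :: s) ->
  indep2 P (X j) (fun x => \sum_(i <- s) X i x).
Proof.
move=> iX us; have := @indep_sum_cat X [:: j] s iX us.
by under eq_fun do rewrite big_seq1.
Qed.

Definition compRV X (g : R -> R) (mg : measurable_fun setT g) i : {RV P >-> R} :=
  mkRV (measurableT_comp mg (@measurable_funPT _ _ _ _ (X i))).

Lemma iid_comp X (g : R -> R) (mg : measurable_fun setT g) : iid X -> iid (compRV X mg).
Proof.
move=> [iX dX].
have mgB (B : set R) : measurable B -> measurable (g @^-1` B).
  by move=> mB; rewrite -[X in measurable X]setTI; exact: mg.
split=> [s us B mB|i B mB].
- exact: (iX s us (fun i => g @^-1` B i) (fun i => mgB _ (mB i))).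
- exact: (dX i (g @^-1` B) (mgB _ mB)).
Qed.

Lemma EV_id_distr X (g : R -> R) i : identically_distributed X -> measurable_fun setT g ->
  (forall j, bm (fun x => g (X j x))) ->
  EV P (fun x => g (X i x)) = EV P (fun x => g (X 0%N x)).
Proof.
move=> dX mg bg; rewrite /EV /Rintegral; congr fine.
have mEg : measurable_fun setT (EFin \o g) by exact/measurable_EFinP.
rewrite -(integral_distribution (X := X i) mEg); last exact: (bm_integrable P (bg i)).
rewrite -(integral_distribution (X := X 0%N) mEg); last exact: (bm_integrable P (bg 0%N)).
apply: eq_measure_integral => A mA _.
exact: dX.
Qed.

End mutual_independence.

(** * Exponential upper bound *)

Section exponential_bound.
Context {R : realType}.
Implicit Types (v w : R).

(** Squaring e^(-v/2) >= 1 - v/2 gives e^(-v) >= (1 - v/2)^2, and (1 + v + v^2)(1 - v/2)^2 = 1 + v^2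
    (1 - 3 v + v^2)/4 is at least 1 for v <= 1/3. *)
Lemma expR_le_quad v : v <= 3^-1 -> expR v <= 1 + v + v ^+ 2.
Proof.
move=> v3; have e1 : 1 - v / 2 <= expR (- v / 2) by have := @expR_ge1Dx R (- v / 2); lra.
have e2 : (1 - v / 2) ^+ 2 <= expR (- v).
  have -> : - v = - v / 2 + - v / 2 by lra.
  by rewrite expRD expr2 ler_pM//; lra.
have q0 : 0 < 1 + v + v ^+ 2 by have := sqr_ge0 (v + 2^-1); rewrite !expr2; lra.
rewrite -[v in expR v]opprK expRN invf_ple ?posrE ?expR_gt0//.
apply: le_trans e2; rewrite -[_^-1]mul1r ler_pdivrMr//.
have : 0 <= v ^+ 2 * (1 - 3 * v + v ^+ 2) by apply: mulr_ge0; rewrite ?sqr_ge0//; have := sqr_ge0 v; lra.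
by rewrite !expr2; nra.
Qed.

(** Above 1/3 the factor 27 |v|^3 exceeds 1, so the last term alone dominates e^v. Since w will be
    constant, integration leaves only the third moment. *)
Lemma expR_le_cubic v w : `|v| <= w ->
  expR v <= 1 + v + v ^+ 2 + 27 * `|v| ^+ 3 * expR w.
Proof.
move=> vw; have [v3|v3] := leP v 3^-1.
  apply: (le_trans (expR_le_quad v3)); rewrite lerDl.
  by rewrite !mulr_ge0// ?exprn_ge0// expR_ge0.
have v0 : 0 < v by apply: lt_trans v3; rewrite invr_gt0.
rewrite gtr0_norm// in vw *.
have h1 : 1 <= 27 * v ^+ 3.
  have h : 1 <= 3 * v by lra.
  have -> : 27 * v ^+ 3 = (3 * v) ^+ 3 by rewrite exprMn; lra.
  by rewrite -(expr1n _ 3) lerXn2r ?nnegrE//; lra.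
have h2 : expR v <= 27 * v ^+ 3 * expR w.
  by rewrite -[expR v]mul1r ler_pM// ?expR_ge0// ler_expR.
by have := sqr_ge0 v; lra.
Qed.

Lemma cube_le_expR w : 0 <= w -> w ^+ 3 <= 27 * expR w.
Proof.
move=> w0; have h : w / 3 <= expR (w / 3) by have := expR_ge1Dx (w / 3); lra.
have -> : expR w = expR (w / 3) ^+ 3 by rewrite -expRM_natl; congr expR; lra.
have -> : w ^+ 3 = 27 * (w / 3) ^+ 3 by rewrite expr_div_n; field.
by rewrite ler_pM2l// lerXn2r ?nnegrE ?expR_ge0//; lra.
Qed.

End exponential_bound.

(** * Chernoff bound for sums of bounded variables *)

Section chernoff.
Context {d : measure_display} {T : measurableType d} {R : realType}
  (P : probability T R).

Lemma indep2_comp (U V : T -> R) (g h : R -> R) : measurable_fun setT g ->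
  measurable_fun setT h -> indep2 P U V -> indep2 P (g \o U) (h \o V).
Proof.
move=> mg mh UV A B mA mB.
by apply: (UV (g @^-1` A) (h @^-1` B)); rewrite -[X in measurable X]setTI; [exact: mg|exact: mh].
Qed.

Variables (Y : nat -> {RV P >-> R}) (b : R).
Hypotheses (iidY : iid Y) (Yb : forall i x, `|Y i x| <= b).

Lemma bm_RV i : bm (Y i).
Proof. by split; [exact: measurable_funPT|exists b]. Qed.

Lemma mgf_sum (h : R) (s : seq nat) : uniq s ->
  EV P (fun x => expR (h * \sum_(i <- s) Y i x)) = EV P (fun x => expR (h * Y 0%N x)) ^+ size s.
Proof.
have mh : measurable_fun setT (fun v : R => expR (h * v)).
  by apply: measurableT_comp => //; exact: mulrl_measurable.
elim: s => [_|j s IH us] /=.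
  rewrite expr0 -[RHS](EV_cst P); congr EV; apply/funext => x.
  by rewrite big_nil mulr0 expR0.
have bs : bm (fun x => \sum_(i <- s) Y i x) by apply: bm_sum => i; exact: bm_RV.
have us' : uniq s by case/andP: us.
rewrite exprS -(IH us').
rewrite -(EV_id_distr j iidY.2 mh); last first.
  by move=> i; apply: bm_expR; apply: bm_scale; exact: bm_RV.
rewrite -EV_indep.
- by congr EV; apply/funext => x; rewrite big_cons mulrDr expRD.
- by apply: bm_expR; apply: bm_scale; exact: bm_RV.
- by apply: bm_expR; apply: bm_scale.
- exact: (indep2_comp mh mh (indep_sum_cons iidY.1 us)).
Qed.

Let mu := EV P (Y 0%N).
Let T2 := EV P (fun x => Y 0%N x ^+ 2).
Let beta := EV P (fun x => `|Y 0%N x| ^+ 3).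

Lemma mgf_le (h : R) : 0 <= h ->
  EV P (fun x => expR (h * Y 0%N x)) <=
  expR (h * mu + h ^+ 2 * T2 + 27 * h ^+ 3 * expR (h * b) * beta).
Proof.
move=> h0; have b0 := bm_RV 0%N.
apply: (le_trans _ (expR_ge1Dx _)).
have bb : bm (fun x => `|Y 0%N x| ^+ 3) by apply: bm_exp; exact: bm_norm.
have b2 : bm (fun x => Y 0%N x ^+ 2) by exact: bm_exp.
rewrite /mu /T2 /beta -!EV_scale//.
rewrite -EV_add; [|bmt..].
rewrite -EV_add; [|bmt..].
rewrite -[X in X + _](EV_cst P) -EV_add; [|bmt..].
apply: EV_le; [bmt..|].
move=> x; have hv : `|h * Y 0%N x| <= h * b by rewrite normrM ger0_norm// ler_wpM2l.
apply: le_trans (expR_le_cubic hv) _.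
by rewrite normrM (ger0_norm h0) !exprMn; lra.
Qed.

Lemma chernoff_truncated (h x : R) (n : nat) : 0 < h ->
  Pr P [set w | n%:R * mu + x <= \sum_(i < n) Y i w] <=
  expR (- (h * x) + n%:R * (h ^+ 2 * T2 + 27 * h ^+ 3 * expR (h * b) * beta)).
Proof.
move=> h0; have bS : bm (fun w => \sum_(i < n) Y i w).
  by apply: bm_sum => i; exact: bm_RV.
have mA : measurable [set w | n%:R * mu + x <= \sum_(i < n) Y i w].
  by apply: measurable_set_le => //; case: bS.
have := @Pr_markov _ _ _ P (fun w => expR (h * \sum_(i < n) Y i w)) _ (expR (h * (n%:R * mu + x)))
  (bm_expR (bm_scale h bS)) mA (fun=> expR_ge0 _).
have -> : EV P (fun w => expR (h * \sum_(i < n) Y i w)) = EV P (fun x => expR (h * Y 0%N x)) ^+ n.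
  have := mgf_sum h (iota_uniq 0 n); rewrite size_iota => <-.
  by congr EV; apply/funext => w; rewrite -(big_mkord xpredT (fun i => Y i w)) /index_iota subn0.
move=> H.
have {}H : expR (h * (n%:R * mu + x)) * Pr P [set w | n%:R * mu + x <= \sum_(i < n) Y i w] <=
    expR (h * mu + h ^+ 2 * T2 + 27 * h ^+ 3 * expR (h * b) * beta) ^+ n.
  apply: le_trans (H _) _.
    by move=> w /= hw; rewrite ler_expR ler_pM2l.
  by rewrite lerXn2r ?nnegrE ?expR_ge0 ?EV_ge0// ?mgf_le ?ltW// => ?; exact: expR_ge0.
rewrite -(ler_pM2l (expR_gt0 (h * (n%:R * mu + x)))); apply: (le_trans H).
by rewrite -expRM_natl -expRD ler_expR; lra.
Qed.

(** The parameter h has two constraints, n h T2 <= x/2 for the quadratic term and dl e^(2 h b) <= 1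
    for the cubic one; under both, the tail is at most a constant times e^(-h x/2). [h1] and [h2]
    saturate them, and the smaller one is used. The level x = 4 theta b is what turns e^(-h2 x/2)
    into dl^theta. *)
Lemma upper_tail (theta : R) (n : nat) : 0 < b -> 1 <= theta -> (0 < n)%N ->
  Pr P [set w | n%:R * mu + 4 * theta * b <= \sum_(i < n) Y i w] <=
  expR (27 * 27) * ((if T2 == 0 then 0 else expR (- b ^+ 2 / (n%:R * T2))) +
              (n%:R * beta / b ^+ 3) `^ theta).
Proof.
move=> b0 th1 n0; set x := 4 * theta * b; set p := Pr _ _; set dl := n%:R * beta / b ^+ 3.
have nR0 : 0 < n%:R :> R by rewrite ltr0n.
have x0 : 0 < x by rewrite !mulr_gt0//; lra.
have be0 : 0 <= beta by apply: EV_ge0 => w; rewrite exprn_ge0.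
have T0 : 0 <= T2 by apply: EV_ge0 => w; rewrite sqr_ge0.
have b3 : 0 < b ^+ 3 by rewrite exprn_gt0.
have dl0 : 0 <= dl by rewrite divr_ge0 ?mulr_ge0// ltW.
have dlb : n%:R * beta = dl * b ^+ 3 by rewrite /dl divfK// gt_eqF.
have pw0 : 0 <= dl `^ theta by exact: powR_ge0.
have ex0 : 0 <= (if T2 == 0 then 0 else expR (- b ^+ 2 / (n%:R * T2))) :> R.
  by case: ifP => // _; exact: expR_ge0.
have K1 : 1 <= expR (27 * 27) :> R by rewrite -expR0 ler_expR mulr_ge0.
have key h : 0 < h -> n%:R * h * T2 <= x / 2 -> dl * expR (2 * (h * b)) <= 1 ->
    p <= expR (27 * 27) * expR (- (h * x / 2)).
  move=> h0 h1 h2; apply: le_trans (chernoff_truncated x n h0) _.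
  rewrite -expRD ler_expR.
  have e1 : n%:R * (h ^+ 2 * T2) <= h * x / 2.
    have := ler_wpM2l (ltW h0) h1; rewrite expr2; lra.
  have hb0 : 0 <= h * b by rewrite mulr_ge0 ?ltW.
  (* One factor 27 is the remainder constant of [expR_le_cubic], the other replaces (h b)^3 e^(h b)
     by 27 e^(2 h b). *)
  have e2 : n%:R * (27 * h ^+ 3 * expR (h * b) * beta) <= 27 * 27.
    have -> : n%:R * (27 * h ^+ 3 * expR (h * b) * beta) =
        27 * (dl * ((h * b) ^+ 3 * expR (h * b))).
      transitivity (27 * h ^+ 3 * expR (h * b) * (n%:R * beta)); first by ring.
      by rewrite dlb exprMn; ring.
    have c3 := cube_le_expR hb0.
    have : (h * b) ^+ 3 * expR (h * b) <= 27 * expR (2 * (h * b)).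
      have -> : 2 * (h * b) = h * b + h * b by lra.
      by rewrite expRD mulrA ler_pM2r ?expR_gt0.
    move=> /(ler_wpM2l dl0); lra.
  lra.
have [T20|T2n0] := eqVneq T2 0.
  have bT : beta <= b * T2.
    rewrite /T2 -EV_scale; last by apply: bm_exp; exact: bm_RV.
    apply: EV_le.
    - by apply: bm_exp; apply: bm_norm; exact: bm_RV.
    - by apply: bm_scale; apply: bm_exp; exact: bm_RV.
    - by move=> w; rewrite exprS real_normK ?num_real// ler_wpM2r// sqr_ge0.
  have dl00 : dl = 0 by rewrite /dl (_ : beta = 0) ?mulr0 ?mul0r//; apply/le_anti; rewrite be0 (le_trans bT)// T20 mulr0.
  suff : p <= 0 by move=> h; apply: (le_trans h); rewrite mulr_ge0 ?expR_ge0// addr_ge0.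
  rewrite leNgt; apply/negP => p0.
  (* With vanishing second and third moments every h > 0 is admissible. Taking h = 2 y/x gives p <=
     e^(27 * 27) e^(-y) < e^(27 * 27)/y = p. *)
  pose y := expR (27 * 27) / p.
  have y0 : 0 < y by apply: divr_gt0; [exact: expR_gt0|exact: p0].
  have h0 : 0 < y / x * 2 by rewrite mulr_gt0// divr_gt0.
  have : p <= expR (27 * 27) * expR (- (y / x * 2 * x / 2)).
    by apply: key => //; rewrite ?T20 ?dl00 ?mulr0 ?mul0r//; lra.
  have -> : y / x * 2 * x / 2 = y by field; rewrite gt_eqF.
  rewrite expRN; apply/negP; rewrite -ltNge.
  have : y < expR y by have := expR_ge1Dx y; lra.
  move=> h; rewrite ltr_pdivrMr ?expR_gt0//.
  by move: h; rewrite {1}/y ltr_pdivrMr// [X in _ < X]mulrC.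
have T2p : 0 < T2 by rewrite lt_def T2n0.
have nT0 : 0 < n%:R * T2 by rewrite mulr_gt0.
pose h1 := x / (2 * (n%:R * T2)).
have h10 : 0 < h1 by rewrite divr_gt0// mulr_gt0.
have h1E : n%:R * h1 * T2 = x / 2.
  by rewrite /h1; field; rewrite !gt_eqF.
have E1 : p <= expR (27 * 27) * expR (- (h1 * x / 2)) ->
    p <= expR (27 * 27) * (expR (- b ^+ 2 / (n%:R * T2)) + dl `^ theta).
  move=> h; apply: (le_trans h); rewrite ler_pM2l ?expR_gt0//.
  apply: (@le_trans _ _ (expR (- b ^+ 2 / (n%:R * T2)))); last by rewrite lerDl.
  rewrite ler_expR /h1 mulNr lerN2 ler_pdivrMr//.
  have -> : x / (2 * (n%:R * T2)) * x / 2 * (n%:R * T2) = x ^+ 2 / 4.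
    by field; rewrite !gt_eqF.
  have -> : x ^+ 2 / 4 = 4 * theta ^+ 2 * b ^+ 2 by rewrite /x; field.
  by rewrite -[leLHS]mul1r ler_pM2r ?exprn_gt0//; nra.
have [dl00|dln0] := eqVneq dl 0.
  by apply: E1; apply: key; rewrite ?h1E// dl00 mul0r.
have dlp : 0 < dl by rewrite lt_def dln0.
have [dl1|dl1] := leP 1 dl.
  have mA : measurable [set w | n%:R * mu + x <= \sum_(i < n) Y i w].
    have [mS _] : bm (fun w => \sum_(i < n) Y i w) by apply: bm_sum => i; exact: bm_RV.
    exact: measurable_set_le.
  apply: (le_trans (Pr_le1 P mA)); rewrite -[leLHS]mulr1 ler_pM//.
  apply: (@le_trans _ _ (dl `^ theta)); last by rewrite lerDr expR_ge0.
  have <- : 1 `^ theta = 1 :> R by rewrite powR1.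
  by rewrite ge0_ler_powR ?nnegrE//; lra.
pose h2 := - ln dl / (2 * b).
have ln0 : ln dl < 0 by rewrite ln_lt0// dlp.
have h20 : 0 < h2 by rewrite divr_gt0 ?mulr_gt0//; lra.
have h2E : expR (2 * (h2 * b)) = dl^-1.
  have -> : 2 * (h2 * b) = - ln dl by rewrite /h2; field; rewrite gt_eqF.
  by rewrite expRN lnK ?posrE.
have [h12|h12] := leP h1 h2.
  apply: E1; apply: key; rewrite ?h1E//.
  apply: (@le_trans _ _ (dl * dl^-1)); last by rewrite divff.
  by rewrite ler_pM2l// -h2E ler_expR ler_pM2l// ler_pM2r.
have : p <= expR (27 * 27) * expR (- (h2 * x / 2)).
  apply: key => //; last by rewrite h2E divff.
  rewrite -h1E ler_pM2r// ler_pM2l//; exact: ltW.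
move=> h; apply: (le_trans h); rewrite ler_pM2l ?expR_gt0//.
apply: (@le_trans _ _ (dl `^ theta)); last by rewrite lerDr expR_ge0.
rewrite /powR (negbTE dln0) ler_expR /h2 /x.
by have -> : - (- ln dl / (2 * b) * (4 * theta * b) / 2) = theta * ln dl by field; rewrite gt_eqF.
Qed.

End chernoff.

(** * Lower bound by blocks *)

Section lower_bound_poly.
Context {R : realType}.
Implicit Types z : R.

(* The quartic is a minorant of 400 * 1{z >= 1/100} whose mean is at least 1/4 as soon as
   E z >= 0, E z^2 = 1 and E z^4 <= 160: a one-sided Paley-Zygmund inequality. *)
Lemma quartic_le0 z : z < 100^-1 -> 18 * z + z ^+ 2 - 320^-1 * z ^+ 4 - 4^-1 <= 0.
Proof.
move=> z1; have z4 : 0 <= z ^+ 4 by rewrite exprn_even_ge0.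
have [z0|z0] := leP 0 z; first by rewrite expr2; nra.
(* 18^2 = 324 exceeds 320: below -18 the quartic term beats z^2, and on [-18, 0] the linear term
   does. *)
have [z18|z18] := leP (-18) z; first by rewrite expr2; nra.
have : 0 <= z ^+ 2 * (z ^+ 2 - 320) by apply: mulr_ge0; [exact: sqr_ge0|rewrite expr2; nra].
have -> : z ^+ 4 = z ^+ 2 * z ^+ 2 by rewrite -exprD.
lra.
Qed.

Lemma quartic_le z : 18 * z + z ^+ 2 - 320^-1 * z ^+ 4 - 4^-1 <= 400.
Proof.
have -> : z ^+ 4 = z ^+ 2 * z ^+ 2 by rewrite -exprD.
have := sqr_ge0 (z ^+ 2 - 320); have := sqr_ge0 (z ^+ 2 - 200); have := sqr_ge0 (z - 72 / 5).
by rewrite !expr2; nra.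
Qed.

End lower_bound_poly.

(** * Moments of block sums and the resulting lower bounds *)

Section moments.
Context {d : measure_display} {T : measurableType d} {R : realType}
  (P : probability T R).

Section centered.
Variables (Z : nat -> {RV P >-> R}) (b : R).
Hypotheses (iidZ : iid Z) (Zb : forall i x, `|Z i x| <= b) (Z0 : EV P (Z 0%N) = 0).

Let bZ i : bm (Z i) := bm_RV Zb i.
Let bS (s : seq nat) : bm (fun x => \sum_(i <- s) Z i x).
Proof. exact: bm_sum. Qed.

Let EZ (g : R -> R) i : measurable_fun setT g -> (forall j, bm (fun x => g (Z j x))) ->
  EV P (fun x => g (Z i x)) = EV P (fun x => g (Z 0%N x)).
Proof. by move=> mg bg; exact: (EV_id_distr i iidZ.2 mg bg). Qed.

Let mX n : measurable_fun setT (fun v : R => v ^+ n).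
Proof. exact: exprn_measurable. Qed.

Let EVcons j s k l : uniq (j :: s) ->
  EV P (fun x => Z j x ^+ k * (\sum_(i <- s) Z i x) ^+ l) =
  EV P (fun x => Z 0%N x ^+ k) * EV P (fun x => (\sum_(i <- s) Z i x) ^+ l).
Proof.
move=> us; rewrite EV_indep; [|bmt|bmt|].
  by congr (_ * _); rewrite (@EZ (fun v => v ^+ k))// => i; bmt.
exact: (indep2_comp (mX k) (mX l) (indep_sum_cons iidZ.1 us)).
Qed.

Let Z01 : EV P (fun x => Z 0%N x ^+ 1) = 0. Proof. exact: Z0. Qed.

(** Expand (Z_j + S)^4: the terms with a first power of Z_j or of S vanish, and 6 n V^2 fits into
    the growth of 3 n^2 V^2. First moments are written with [^+ 1] so that [EVcons] treats all terms
    alike. *)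
Lemma centered_sum_moments (s : seq nat) : uniq s ->
  [/\ EV P (fun x => (\sum_(i <- s) Z i x) ^+ 1) = 0,
      EV P (fun x => (\sum_(i <- s) Z i x) ^+ 2) = (size s)%:R * EV P (fun x => Z 0%N x ^+ 2) &
      EV P (fun x => (\sum_(i <- s) Z i x) ^+ 4) <=
        3 * (size s)%:R ^+ 2 * EV P (fun x => Z 0%N x ^+ 2) ^+ 2
        + (size s)%:R * EV P (fun x => Z 0%N x ^+ 4)].
Proof.
have V0 : 0 <= EV P (fun x => Z 0%N x ^+ 2) by apply: EV_ge0 => x; exact: sqr_ge0.
elim: s => [_|j s IH us].
  have E n : (0 < n)%N -> EV P (fun x => (\sum_(i <- [::]) Z i x) ^+ n) = 0.
    case: n => // n _; rewrite -[RHS](EV_cst P); congr EV.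
    by apply/funext => x; rewrite big_nil expr0n.
  by rewrite !E// /=; split => //; lra.
have us' : uniq s by case/andP: us.
have [I1 I2 I4] := IH us'.
set V := EV P (fun x => Z 0%N x ^+ 2) in V0 I2 I4 *.
set Q := EV P (fun x => Z 0%N x ^+ 4) in I4 *.
have Ec n : EV P (fun x => (\sum_(i <- j :: s) Z i x) ^+ n) =
    EV P (fun x => (Z j x + \sum_(i <- s) Z i x) ^+ n).
  by congr EV; apply/funext => x; rewrite big_cons.
have S0 : EV P (fun x => (\sum_(i <- s) Z i x) ^+ 0) = 1.
  by rewrite -[RHS](EV_cst P).
have Z00 : EV P (fun x => Z 0%N x ^+ 0) = 1 by rewrite -[RHS](EV_cst P).
have c k l := EVcons k l us.
rewrite !Ec /=.
have sz : (size s).+1%:R = (size s)%:R + 1 :> R by rewrite -addn1 natrD.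
split.
- transitivity (EV P (fun x => Z j x ^+ 1 * (\sum_(i <- s) Z i x) ^+ 0 +
    Z j x ^+ 0 * (\sum_(i <- s) Z i x) ^+ 1)).
    by congr EV; apply/funext => x; ring.
  rewrite EV_add; [|bmt..].
  by rewrite !c I1 Z01; ring.
- transitivity (EV P (fun x => Z j x ^+ 2 * (\sum_(i <- s) Z i x) ^+ 0 +
    (2 * (Z j x ^+ 1 * (\sum_(i <- s) Z i x) ^+ 1) +
    Z j x ^+ 0 * (\sum_(i <- s) Z i x) ^+ 2))).
    by congr EV; apply/funext => x; ring.
  rewrite EV_add; [|bmt..].
  rewrite EV_add; [|bmt..].
  rewrite EV_scale; [|bmt..].
  by rewrite !c I1 I2 Z01 S0 ?Z00 sz -/V; ring.
- have -> : EV P (fun x => (Z j x + \sum_(i <- s) Z i x) ^+ 4) =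
   EV P (fun x => Z j x ^+ 4 * (\sum_(i <- s) Z i x) ^+ 0 +
    (4 * (Z j x ^+ 3 * (\sum_(i <- s) Z i x) ^+ 1) +
    (6 * (Z j x ^+ 2 * (\sum_(i <- s) Z i x) ^+ 2) +
    (4 * (Z j x ^+ 1 * (\sum_(i <- s) Z i x) ^+ 3) +
    Z j x ^+ 0 * (\sum_(i <- s) Z i x) ^+ 4)))).
    by congr EV; apply/funext => x; ring.
  rewrite EV_add; [|bmt..].
  rewrite EV_add; [|bmt..].
  rewrite EV_add; [|bmt..].
  rewrite EV_add; [|bmt..].
  rewrite !EV_scale; [|bmt..].
  rewrite !c I1 I2 Z01 S0 ?Z00 sz -/V -/Q.
  have : 0 <= V ^+ 2 by exact: sqr_ge0.
  by rewrite !expr2 in I4 *; nra.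
Qed.

End centered.

Variables (Y : nat -> {RV P >-> R}) (b : R).
Hypotheses (iidY : iid Y) (Yb : forall i x, `|Y i x| <= b).
Let mu := EV P (Y 0%N).
Let T2 := EV P (fun x => Y 0%N x ^+ 2).
Let Q := EV P (fun x => Y 0%N x ^+ 4).

Let bY i : bm (Y i) := bm_RV Yb i.

(** The comparison is with the second moment n V + n^2 mu^2, so it tolerates any drift. The constant
    is 160 = 8 (3 + 8 + 8 + 1), where 8 is that of (u + v)^4 <= 8 (u^4 + v^4), used for the sum and
    again for each centered variable. *)
Lemma sum_moments (s : seq nat) : uniq s -> (0 < size s)%N -> Q <= (size s)%:R * T2 ^+ 2 ->
  [/\ EV P (fun x => \sum_(i <- s) Y i x) = (size s)%:R * mu,
      (size s)%:R * T2 <= EV P (fun x => (\sum_(i <- s) Y i x) ^+ 2) &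
      EV P (fun x => (\sum_(i <- s) Y i x) ^+ 4) <=
        160 * EV P (fun x => (\sum_(i <- s) Y i x) ^+ 2) ^+ 2].
Proof.
move=> us s0 QT.
have mg : measurable_fun setT (fun v : R => v - mu).
  by apply: measurable_funD => //; exact: measurable_cst.
pose Z := compRV Y mg.
have iidZ : iid Z by exact: iid_comp.
have Zb i x : `|Z i x| <= b + `|mu|.
  by apply: (le_trans (ler_normB _ _)); rewrite lerD2r.
have ZE : EV P (Z 0%N) = 0.
  by rewrite (_ : EV P _ = EV P (fun x => Y 0%N x - mu))// EV_sub ?EV_cst ?subrr//; bmt.
have bZ i := bm_RV Zb i.
have [M1 M2 M4] := centered_sum_moments iidZ Zb ZE us.
set V := EV P (fun x => Z 0%N x ^+ 2) in M2 M4.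
set W := EV P (fun x => Z 0%N x ^+ 4) in M4.
have VE : T2 = V + mu ^+ 2.
  have -> : V = EV P (fun x => Y 0%N x ^+ 2 - (2 * mu * Y 0%N x - mu ^+ 2)).
    by congr EV; apply/funext => x /=; ring.
  rewrite EV_sub; [|bmt..].
  rewrite EV_sub; [|bmt..].
  by rewrite EV_scale// EV_cst -/mu -/T2; ring.
have V0 : 0 <= V by apply: EV_ge0 => x; exact: sqr_ge0.
have WQ : W <= 8 * (Q + mu ^+ 4).
  rewrite -[mu ^+ 4](EV_cst P) -EV_add; [|bmt..].
  rewrite -EV_scale; [|bmt].
  apply: EV_le; [bmt..|] => x /=.
  set u := Y 0%N x.
  have := sqr_ge0 (u + mu); have := sqr_ge0 (u - mu); have := sqr_ge0 (u ^+ 2 - mu ^+ 2).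
  have -> : (u - mu) ^+ 4 = ((u - mu) ^+ 2) ^+ 2 by rewrite -exprM.
  have -> : u ^+ 4 = (u ^+ 2) ^+ 2 by rewrite -exprM.
  have -> : mu ^+ 4 = (mu ^+ 2) ^+ 2 by rewrite -exprM.
  have h : (u - mu) ^+ 2 + (u + mu) ^+ 2 = 2 * (u ^+ 2 + mu ^+ 2) by ring.
  move: ((u - mu) ^+ 2) ((u + mu) ^+ 2) (u ^+ 2) (mu ^+ 2) h => a1 a2 a3 a4.
  by rewrite !expr2; nra.
set N := (size s)%:R in QT M2 M4 *.
have N1 : 1 <= N by rewrite /N ler1n.
have SE x : \sum_(i <- s) Y i x = \sum_(i <- s) Z i x + N * mu.
  rewrite /Z /= big_split /= sumrN; rewrite big_const_seq count_predT iter_addr addr0 -mulr_natl.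
  by rewrite -/N; ring.
have bSZ : bm (fun x => \sum_(i <- s) Z i x) by apply: bm_sum.
have E2 : EV P (fun x => (\sum_(i <- s) Y i x) ^+ 2) = N * V + N ^+ 2 * mu ^+ 2.
  transitivity (EV P (fun x => (\sum_(i <- s) Z i x) ^+ 2 +
    (2 * N * mu * (\sum_(i <- s) Z i x) ^+ 1 + N ^+ 2 * mu ^+ 2))).
    by congr EV; apply/funext => x; rewrite SE; ring.
  rewrite EV_add; [|bmt..].
  rewrite EV_add; [|bmt..].
  by rewrite EV_scale ?EV_cst ?M1 ?M2; [ring|bmt].
have E4 : EV P (fun x => (\sum_(i <- s) Y i x) ^+ 4) <= 8 * ((3 * N ^+ 2 * V ^+ 2 + N * W) + N ^+ 4 * mu ^+ 4).
  apply: (@le_trans _ _ (EV P (fun x => 8 * ((\sum_(i <- s) Z i x) ^+ 4 + N ^+ 4 * mu ^+ 4)))).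
    apply: EV_le; [by apply: bm_exp; exact: bm_sum|bmt|] => x; rewrite SE.
    rewrite -exprMn; move: (\sum_(i <- s) Z i x) (N * mu) => u v.
    have := sqr_ge0 (u + v); have := sqr_ge0 (u - v); have := sqr_ge0 (u ^+ 2 - v ^+ 2).
    have -> : (u + v) ^+ 4 = ((u + v) ^+ 2) ^+ 2 by rewrite -exprM.
    have -> : u ^+ 4 = (u ^+ 2) ^+ 2 by rewrite -exprM.
    have -> : v ^+ 4 = (v ^+ 2) ^+ 2 by rewrite -exprM.
    have h : (u - v) ^+ 2 + (u + v) ^+ 2 = 2 * (u ^+ 2 + v ^+ 2) by ring.
    move: ((u - v) ^+ 2) ((u + v) ^+ 2) (u ^+ 2) (v ^+ 2) h => a1 a2 a3 a4.
    by rewrite !expr2; nra.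
  rewrite EV_scale; [|bmt].
  rewrite EV_add; [|bmt..].
  by rewrite EV_cst; lra.
split.
- transitivity (EV P (fun x => (\sum_(i <- s) Z i x) ^+ 1 + N * mu)).
    by congr EV; apply/funext => x; rewrite SE.
  by rewrite EV_add; [rewrite M1 EV_cst add0r|bmt..].
- rewrite E2 VE; have := sqr_ge0 mu; nra.
- rewrite E2; apply: (le_trans E4).
  have mu20 := sqr_ge0 mu.
  have mu4 : mu ^+ 4 = mu ^+ 2 * mu ^+ 2 by rewrite -exprD.
  have N4 : N ^+ 4 = N ^+ 2 * N ^+ 2 by rewrite -exprD.
  have NN : N <= N ^+ 2 by rewrite expr2 ler_peMr; lra.
  have WN : N * W <= 8 * (N ^+ 2 * T2 ^+ 2 + N ^+ 2 * (mu ^+ 2 * mu ^+ 2)).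
    apply: (@le_trans _ _ (N * (8 * (Q + mu ^+ 4)))); first by rewrite ler_wpM2l; lra.
    rewrite mu4; have h1 : N * Q <= N * (N * T2 ^+ 2) by rewrite ler_wpM2l; lra.
    have h2 : N * (mu ^+ 2 * mu ^+ 2) <= N ^+ 2 * (mu ^+ 2 * mu ^+ 2).
      by apply: ler_wpM2r => //; exact: mulr_ge0.
    rewrite expr2 in h2 *; lra.
  have p1 : N * V + N * mu ^+ 2 <= N * V + N ^+ 2 * mu ^+ 2.
    by rewrite lerD2l; apply: ler_wpM2r.
  have p0 : 0 <= N * V by rewrite mulr_ge0//; lra.
  have p0' : 0 <= N * mu ^+ 2 by rewrite mulr_ge0//; lra.
  have p2 : (N * V + N * mu ^+ 2) ^+ 2 <= (N * V + N ^+ 2 * mu ^+ 2) ^+ 2.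
    by rewrite lerXn2r ?nnegrE//; lra.
  have e1 : N ^+ 2 * T2 ^+ 2 = (N * V + N * mu ^+ 2) ^+ 2 by rewrite VE; ring.
  have e2 : N ^+ 2 * V ^+ 2 <= (N * V + N ^+ 2 * mu ^+ 2) ^+ 2.
    by rewrite -exprMn lerXn2r ?nnegrE//; lra.
  have e3 : N ^+ 4 * mu ^+ 4 <= (N * V + N ^+ 2 * mu ^+ 2) ^+ 2.
    have -> : N ^+ 4 * mu ^+ 4 = (N ^+ 2 * mu ^+ 2) ^+ 2 by rewrite N4 mu4; ring.
    have p3 : 0 <= N ^+ 2 * mu ^+ 2 by rewrite mulr_ge0 ?sqr_ge0.
    by rewrite lerXn2r ?nnegrE//; lra.
  have e4 : N ^+ 2 * (mu ^+ 2 * mu ^+ 2) <= N ^+ 2 * T2 ^+ 2.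
    by rewrite ler_wpM2l ?sqr_ge0// expr2 ler_pM//; lra.
  lra.
Qed.

(** The quartic minorant is evaluated at the block sum divided by the root of its second moment. Its
    mean is at least 1 - 160/320 - 1/4 = 1/4, and division by 400 gives 1/1600. *)
Lemma block_lower (s : seq nat) : uniq s -> (0 < size s)%N -> Q <= (size s)%:R * T2 ^+ 2 ->
  0 <= mu -> 0 < T2 ->
  (40 * 40)^-1 <= Pr P [set w | Num.sqrt ((size s)%:R * T2) / 100 <= \sum_(i <- s) Y i w].
Proof.
move=> us s0 QT mu0 T0; have [M1 M2 M4] := sum_moments us s0 QT.
set S := fun w => \sum_(i <- s) Y i w.
have bS : bm S by exact: bm_sum.
set s2 := EV P (fun x => (\sum_(i <- s) Y i x) ^+ 2) in M2 M4.
have sT : 0 < (size s)%:R * T2 by rewrite mulr_gt0// ltr0n.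
have s20 : 0 < s2 by exact: lt_le_trans M2.
pose sg := Num.sqrt s2; have sg0 : 0 < sg by rewrite sqrtr_gt0.
have sg2 : sg ^+ 2 = s2 by rewrite sqr_sqrtr// ltW.
set A := [set w | _]; have mA : measurable A.
  by apply: measurable_set_le => //; case: bS.
have sgT : Num.sqrt ((size s)%:R * T2) <= sg by rewrite ler_sqrt// ltW.
have : EV P (fun w => 18 * (sg^-1 * S w) + (sg^-1 * S w) ^+ 2
    - 320^-1 * (sg^-1 * S w) ^+ 4 - 4^-1) <= EV P (fun w => 400 * \1_A w).
  apply: EV_le; [bmt|by apply: bm_scale; exact: bm_indic|] => w.
  rewrite indicE; case: (boolP (w \in A)) => [_|wA].
    by rewrite mulr1; exact: quartic_le.
  rewrite mulr0; apply: quartic_le0; rewrite mulrC ltr_pdivrMr//.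
  move: wA; rewrite notin_setE /A /= => /negP; rewrite -ltNge => h.
  by apply: (lt_le_trans h); lra.
rewrite EV_scale; last exact: bm_indic.
rewrite EV_indic// !EV_sub; [|bmt..].
rewrite EV_add; [|bmt..].
rewrite !EV_scale; [|bmt..].
rewrite EV_cst.
have -> : EV P (fun w => (sg^-1 * S w) ^+ 2) = sg^-1 ^+ 2 * s2.
  by rewrite /s2 -EV_scale; [congr EV; apply/funext => w; rewrite exprMn|bmt].
have -> : EV P (fun w => (sg^-1 * S w) ^+ 4) = sg^-1 ^+ 4 * EV P (fun w => S w ^+ 4).
  by rewrite -EV_scale; [congr EV; apply/funext => w; rewrite exprMn|bmt].
have h1 : sg^-1 ^+ 2 * s2 = 1 by rewrite -sg2 exprVn mulVf// sqrf_eq0 gt_eqF.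
have h2 : sg^-1 ^+ 4 * EV P (fun w => S w ^+ 4) <= 160.
  apply: (@le_trans _ _ (sg^-1 ^+ 4 * (160 * s2 ^+ 2))).
    by rewrite ler_wpM2l// exprn_ge0// invr_ge0 ltW.
  have -> : sg^-1 ^+ 4 * (160 * s2 ^+ 2) = 160 * (sg^-1 ^+ 2 * s2) ^+ 2.
    by rewrite exprMn -exprM; ring.
  by rewrite h1 expr1n mulr1.
have h3 : 0 <= sg^-1 * EV P S.
  by rewrite mulr_ge0 ?invr_ge0 ?(ltW sg0)// M1 mulr_ge0.
rewrite h1 => h; lra.
Qed.

(** All of the independent blocks have [m] indices except the last, which takes whatever remains, so
    that the event concerns the sum over the whole of [s]. *)
Lemma blocks_lower (m k : nat) (s : seq nat) : (0 < m)%N -> Q <= m%:R * T2 ^+ 2 ->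
  0 <= mu -> 0 < T2 -> uniq s -> (k.+1 * m <= size s)%N ->
  (40 * 40)^-1 ^+ k.+1 <=
    Pr P [set w | k.+1%:R * (Num.sqrt (m%:R * T2) / 100) <= \sum_(i <- s) Y i w].
Proof.
move=> m0 Qm mu0 T0; have QN N : (m <= N)%N -> Q <= N%:R * T2 ^+ 2.
  move=> mN; apply: (le_trans Qm); rewrite ler_wpM2r ?sqr_ge0//.
  by rewrite ler_nat.
have bS s' : bm (fun w => \sum_(i <- s') Y i w) by exact: bm_sum.
have mS s' c : measurable [set w | c <= \sum_(i <- s') Y i w].
  by apply: measurable_set_le => //; case: (bS s').
elim: k s => [|k IH] s us ks.
  rewrite mul1n in ks; rewrite expr1 mul1r.
  apply: (le_trans (block_lower us (leq_trans m0 ks) (QN _ ks) mu0 T0)).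
  apply: le_Pr => // w /=; apply: le_trans.
  by rewrite ler_pM2r// ler_wsqrtr// ler_wpM2r ?(ltW T0)// ler_nat.
have ms : (m <= size s)%N by lia.
set c := Num.sqrt (m%:R * T2) / 100 in IH *.
rewrite -(cat_take_drop m s) in us *.
have size1 : size (take m s) = m by rewrite size_takel.
have size2 : (k.+1 * m <= size (drop m s))%N by rewrite size_drop; lia.
have [us1 us2] : uniq (take m s) /\ uniq (drop m s).
  by move: us; rewrite cat_uniq => /and3P[].
have H1 := IH _ us2 size2.
have H2 := block_lower us1; rewrite size1 in H2; have {}H2 := H2 m0 Qm mu0 T0.
have ind := indep_sum_cat iidY.1 us.
have E : Pr P ([set w | c <= \sum_(i <- take m s) Y i w] `&`
    [set w | k.+1%:R * c <= \sum_(i <- drop m s) Y i w]) =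
    Pr P [set w | c <= \sum_(i <- take m s) Y i w] *
    Pr P [set w | k.+1%:R * c <= \sum_(i <- drop m s) Y i w].
  apply: EFin_inj; rewrite EFinM -!PrE//; last exact: measurableI.
  exact: (ind [set v | c <= v] [set v | k.+1%:R * c <= v]
    (measurable_set_le (measurable_cst _) (@measurable_id _ _ _))
    (measurable_set_le (measurable_cst _) (@measurable_id _ _ _))).
have c0 : 0 <= (40 * 40)^-1 :> R by rewrite invr_ge0 mulr_ge0.
rewrite exprS; apply: (@le_trans _ _ (Pr P ([set w | c <= \sum_(i <- take m s) Y i w] `&`
    [set w | k.+1%:R * c <= \sum_(i <- drop m s) Y i w]))).
  by rewrite E; apply: ler_pM => //; exact: exprn_ge0.
apply: le_Pr => //; first exact: measurableI.
move=> w /= [h1 h2]; rewrite big_cat /=.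
have -> : k.+2%:R = k.+1%:R + 1 :> R by rewrite -[k.+2]addn1 natrD.
lra.
Qed.

End moments.

(** * Series of truncated moments *)

Section bounded_partial_sums.
Context {R : realType}.
Implicit Types u v : nat -> R.

(** Convergence when the terms are nonnegative, in a form that keeps all comparisons of series in
    the reals. *)
Definition bsum u := exists M : R, forall n, \sum_(1 <= k < n) u k <= M.

Lemma bsumP u : (forall n, (1 <= n)%N -> 0 <= u n) ->
  (\sum_(1 <= n <oo) (u n)%:E < +oo)%E <-> bsum u.
Proof.
move=> u0; have u0E n : (1 <= n)%N -> true -> (0 <= (u n)%:E)%E.
  by move=> n1 _; rewrite lee_fin u0.
split=> [us|[M uM]].
  exists (fine (\sum_(1 <= n <oo) (u n)%:E)) => n.
  rewrite -lee_fin fineK; last by rewrite ge0_fin_numE// nneseries_ge0.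
  by rewrite -sumEFin; apply: nneseries_lim_ge.
apply: (@le_lt_trans _ _ M%:E); last exact: ltry.
apply: lime_le; first exact: is_cvg_nneseries.
by apply: nearW => n; rewrite sumEFin lee_fin.
Qed.

Lemma bsum_add u v : bsum u -> bsum v -> bsum (fun n => u n + v n).
Proof.
by move=> [M uM] [N vN]; exists (M + N) => n; rewrite big_split lerD.
Qed.

Lemma bsum_scale (c : R) u : 0 <= c -> bsum u -> bsum (fun n => c * u n).
Proof.
by move=> c0 [M uM]; exists (c * M) => n; rewrite -mulr_sumr ler_wpM2l.
Qed.

Lemma bsum_tail u n0 (M : R) : (1 <= n0)%N ->
  (forall n, \sum_(n0 <= k < n) u k <= M) -> bsum u.
Proof.
move=> n1 uM; exists (\sum_(1 <= k < n0) `|u k| + M) => n.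
have [nn|nn] := leqP n0 n.
  rewrite (big_cat_nat n1 nn) /= lerD//.
  by apply: ler_sum => k _; exact: ler_norm.
apply: (@le_trans _ _ (\sum_(1 <= k < n0) `|u k|)); last first.
  by rewrite lerDl; apply: le_trans (uM 0%N); rewrite big_geq.
apply: (@le_trans _ _ (\sum_(1 <= k < n) `|u k|)).
  by apply: ler_sum => k _; exact: ler_norm.
have [n1'|n1'] := leqP 1 n; last by rewrite big_geq ?sumr_ge0//; exact: ltnW.
by rewrite (big_cat_nat n1' (ltnW nn)) /= lerDl sumr_ge0.
Qed.

Lemma bsum_le u v n0 : (forall n, (1 <= n)%N -> 0 <= v n) ->
  (forall n, (1 <= n)%N -> (n0 <= n)%N -> u n <= v n) -> bsum v -> bsum u.
Proof.
move=> v0 uv [M vM]; apply: (@bsum_tail _ (maxn 1 n0) M); first exact: leq_maxl.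
move=> n; apply: (le_trans _ (vM n)).
apply: (@le_trans _ _ (\sum_(maxn 1 n0 <= k < n) v k)).
  by apply: ler_sum_nat => k /andP[kn _]; apply: uv; lia.
have [nn|nn] := leqP (maxn 1 n0) n; last first.
  rewrite big_geq; last exact: ltnW.
  by rewrite big_nat_cond sumr_ge0// => k /andP[/andP[k1 _] _]; exact: v0.
rewrite [leRHS](@big_cat_nat _ _ _ (maxn 1 n0))//= ?leq_maxl// lerDr.
by rewrite big_nat_cond sumr_ge0// => k /andP[/andP[k1 _] _]; exact: v0.
Qed.

End bounded_partial_sums.

(** * Summation by parts under the hypotheses on the weights and the normalization *)

Section tail_condition.
Context {R : realType}.

Lemma powR_predr (theta x : R) : 0 < x -> x `^ theta = x `^ (theta - 1) * x.
Proof.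
move=> x0; have h : (theta - 1 + 1 == 0) ==> (x != 0) by rewrite (gt_eqF x0) implybT.
by have := powRD h; rewrite subrK (powRr1 (ltW x0)).
Qed.

(** A substitute for the mean value theorem: with r = y/x one has r^theta >= r^J, and Bernoulli's
    inequality bounds 1 - r^J by J (1 - r). *)
Lemma powR_sub_le (x y theta : R) (J : nat) : 0 <= y -> y <= x -> 0 < theta -> theta <= J%:R ->
  x `^ theta - y `^ theta <= J%:R * x `^ (theta - 1) * (x - y).
Proof.
move=> y0 yx th0 thJ.
have x0 : 0 <= x by exact: le_trans yx.
have J0 : (0 < J)%N by rewrite lt0n; apply: contraTneq thJ => ->; rewrite -ltNge.
move: x0; rewrite le_eqVlt => /predU1P[x0|x0].
  have -> : y = 0 by apply/le_anti; rewrite y0 x0 yx.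
  by rewrite -x0 powR0 ?gt_eqF// !subrr mulr0.
pose r := y / x.
have r0 : 0 <= r by rewrite divr_ge0// ltW.
have r1 : r <= 1 by rewrite ler_pdivrMr// mul1r.
have yE : y = x * r by rewrite /r mulrC divfK// gt_eqF.
have rJ : r ^+ J <= r `^ theta.
  move: r0; rewrite le_eqVlt => /predU1P[<-|r0]; first by rewrite expr0n gtn_eqF// powR_ge0.
  by rewrite -powR_mulrn ?(ltW r0)// ger_powR// r0.
have bern : 1 - r ^+ J <= J%:R * (1 - r).
  elim: (J) => [|j IH]; first by rewrite expr0; lra.
  have rj : r ^+ j <= 1 by rewrite exprn_ile1.
  by rewrite exprS -addn1 natrD; nra.
have xE := powR_predr theta x0.
have yt : y `^ theta = x `^ theta * r `^ theta by rewrite {1}yE powRM// ltW.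
rewrite yt xE.
have p0 : 0 <= x `^ (theta - 1) * x by rewrite mulr_ge0 ?powR_ge0// ltW.
have := ler_wpM2l p0 bern; have := ler_wpM2l p0 rJ; rewrite yE; lra.
Qed.

(** Increments fall on [B] and tails on [g], because the hypothesis on the weights bounds tails. *)
Lemma abel_sum (g B : nat -> R) n1 l :
  \sum_(n1 <= n < n1 + l) g n * B n =
  B n1 * \sum_(n1 <= n < n1 + l) g n +
  \sum_(n1 <= k < n1 + l) (B k.+1 - B k) * \sum_(k.+1 <= n < n1 + l) g n.
Proof.
elim: l n1 => [|l IH] n1; first by rewrite addn0 !big_geq// mulr0 addr0.
have h : (n1 < n1 + l.+1)%N by lia.
rewrite !(big_ltn h) (_ : n1 + l.+1 = n1.+1 + l)%N; last by lia.
by rewrite IH; ring.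
Qed.

Variables (tau a : nat -> R) (theta C N : R).
Hypotheses (tau0 : forall n, (1 <= n)%N -> 0 <= tau n)
  (a0 : forall n, (1 <= n)%N -> 0 < a n)
  (th1 : 1 <= theta) (C0 : 0 < C).
Let W n := \sum_(1 <= j < n) j%:R * tau j.
Hypothesis hC : forall n M : nat, (1 <= n)%N -> N <= n%:R ->
  (a n `^ (3 * theta) / n%:R `^ (theta - 1)) *
    \sum_(n <= k < M) (k%:R `^ theta * tau k / a k `^ (3 * theta)) <= C * W n.
Hypothesis hlim : 1 < theta -> exists2 c : R, 0 < c & exists n0, forall n k : nat,
  (n0 <= n)%N -> (1 <= n)%N -> (n <= k)%N -> c <= a k ^+ 3 / (k%:R * a n ^+ 3) * W n.

Variables (beta p : nat -> R) (D : R).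
Hypotheses (be0 : forall n, (1 <= n)%N -> 0 <= beta n)
  (beI : forall n, (1 <= n)%N -> beta n <= beta n.+1)
  (p0 : forall n, (1 <= n)%N -> 0 <= p n) (pI : forall n, (1 <= n)%N -> p n.+1 <= p n)
  (D0 : 0 <= D)
  (beD : forall n, (1 <= n)%N -> beta n.+1 - beta n <= D * a n.+1 ^+ 3 * (p n - p n.+1))
  (sp : bsum (fun n => n%:R * tau n * p n)).

Let W0 n : 0 <= W n.
Proof.
rewrite /W big_nat_cond sumr_ge0// => k /andP[/andP[k1 _] _].
by rewrite mulr_ge0// tau0.
Qed.

(** Summation by parts of the series of n tau_n p_n, whose boundary term W p is nonnegative. *)
Let sum_Wdp : exists M, forall k, \sum_(1 <= j < k) W j.+1 * (p j - p j.+1) <= M.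
Proof.
have [M spM] := sp; exists M => k; apply: (le_trans _ (spM k)).
case: k => [|k]; first by rewrite !big_geq.
suff : \sum_(1 <= j < k.+1) W j.+1 * (p j - p j.+1) + W k.+1 * p k.+1 =
    \sum_(1 <= j < k.+1) j%:R * tau j * p j.
  by move=> <-; rewrite lerDl mulr_ge0// p0.
elim: k => [|k IH]; first by rewrite /W !big_geq// mul0r addr0.
rewrite !(big_nat_recr k.+1)//= -IH.
have -> : W k.+2 = W k.+1 + k.+1%:R * tau k.+1 by rewrite /W big_nat_recr.
by ring.
Qed.

Let Wdp0 j : (1 <= j)%N -> 0 <= W j.+1 * (p j - p j.+1).
Proof. by move=> j1; rewrite mulr_ge0// subr_ge0 pI. Qed.

(** The liminf hypothesis reads k a_n^3/a_k^3 <= W_n/c. Inserted into the telescoped beta_k it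
    bounds k beta_k/a_k^3 by a partial sum from [sum_Wdp]. For theta = 1 the exponent is 0 and the
    bound is 1. *)
Let ratio_bounded : exists n0 B : _, forall k, (n0 <= k)%N -> (1 <= k)%N ->
  (k%:R * beta k / a k ^+ 3) `^ (theta - 1) <= B :> R.
Proof.
have [/hlim [c c0 [n0 hc]]|th] := ltP 1 theta; last first.
  exists 0%N, 1 => k _ _; have -> : theta - 1 = 0 by apply/eqP; rewrite subr_eq0 eq_le th1 th.
  by rewrite powRr0.
have [M WM] := sum_Wdp.
pose n1 := maxn n0 1; have n11 : (1 <= n1)%N by rewrite leq_maxr.
have hc' n k : (n1 <= n)%N -> (n <= k)%N -> k%:R * a n ^+ 3 / a k ^+ 3 <= W n / c.
  move=> nn nk; have n1' : (1 <= n)%N by lia. have k1 : (1 <= k)%N by lia.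
  have := hc n k; move=> /(_ _ n1' nk) H.
  have {}H := H ltac:(lia).
  have kk : 0 < k%:R :> R by rewrite ltr0n.
  have ak := exprn_gt0 3 (a0 k1); have an := exprn_gt0 3 (a0 n1').
  rewrite ler_pdivrMr// mulrAC ler_pdivlMr//.
  have kan : 0 < k%:R * a n ^+ 3 by exact: mulr_gt0.
  move: H; rewrite mulrAC ler_pdivlMr// => H; lra.
pose Bd := beta n1 * (W n1 / c / a n1 ^+ 3) + D / c * M.
have bd k : (n1 <= k)%N -> k%:R * beta k / a k ^+ 3 <= Bd.
  move=> nk; have k1 : (1 <= k)%N by lia.
  have ak := exprn_gt0 3 (a0 k1).
  (* Here k stays fixed while beta is built up increment by increment, each weighed against
     k/a_k^3. *)
  have be l : (n1 + l <= k)%N -> k%:R * beta (n1 + l)%N / a k ^+ 3 <=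
      beta n1 * (W n1 / c / a n1 ^+ 3) +
      D / c * \sum_(1 <= j < n1 + l) W j.+1 * (p j - p j.+1).
    elim: l => [|l IH] lk.
      rewrite addn0 in lk *; have an := exprn_gt0 3 (a0 n11).
      have := hc' _ _ (leqnn _) lk => h.
      have : k%:R * beta n1 / a k ^+ 3 <= beta n1 * (W n1 / c / a n1 ^+ 3).
        have -> : k%:R * beta n1 / a k ^+ 3 = beta n1 * (k%:R * a n1 ^+ 3 / a k ^+ 3 / a n1 ^+ 3).
          by field; rewrite !gt_eqF// a0.
        by rewrite ler_wpM2l ?be0// ler_pM2r ?invr_gt0.
      move=> h'; apply: (le_trans h'); rewrite lerDl mulr_ge0//.
        by rewrite divr_ge0// ltW.
      by rewrite big_nat_cond sumr_ge0// => j /andP[/andP[j1 _] _]; exact: Wdp0.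
    have {}IH := IH ltac:(lia).
    rewrite addnS in lk *.
    have h1 := @hc' (n1 + l).+1 k ltac:(lia) lk.
    rewrite big_nat_recr /=; last by lia.
    rewrite mulrDr addrA; set q := p _ - p _.
    have q0 : 0 <= q by rewrite subr_ge0 pI//; lia.
    have h2 := beD (leq_trans n11 (leq_addr l n1)); rewrite -/q in h2.
    have h3 : k%:R * (beta (n1 + l).+1 - beta (n1 + l)%N) / a k ^+ 3 <= D / c * (W (n1 + l).+1 * q).
      apply: (@le_trans _ _ (D * q * (k%:R * a (n1 + l).+1 ^+ 3 / a k ^+ 3))).
        have -> : D * q * (k%:R * a (n1 + l).+1 ^+ 3 / a k ^+ 3) =
          k%:R * (D * a (n1 + l).+1 ^+ 3 * q) / a k ^+ 3 by ring.
        by rewrite ler_pM2r ?invr_gt0// ler_wpM2l.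
      have -> : D / c * (W (n1 + l).+1 * q) = D * q * (W (n1 + l).+1 / c) by ring.
      by rewrite ler_wpM2l// mulr_ge0.
    have -> : k%:R * beta (n1 + l).+1 / a k ^+ 3 = k%:R * beta (n1 + l)%N / a k ^+ 3 +
       k%:R * (beta (n1 + l).+1 - beta (n1 + l)%N) / a k ^+ 3 by ring.
    exact: lerD.
  have := be (k - n1)%N; rewrite subnKC// leqnn => /(_ isT) h; apply: (le_trans h).
  by rewrite lerD2l ler_wpM2l// divr_ge0// ltW.
exists n1, (Bd `^ (theta - 1)) => k nk k1.
have h0 : 0 <= k%:R * beta k / a k ^+ 3.
  by rewrite divr_ge0 ?exprn_ge0 ?(ltW (a0 k1))// mulr_ge0// be0.
have th : 0 <= theta - 1 by rewrite subr_ge0.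
by apply: ge0_ler_powR => //; rewrite ?nnegrE// ?bd// (le_trans h0)// bd.
Qed.

(** Abel summation of g_k beta_k^theta, where the tails of g are at most C W_k k^(theta-1)/a_k^(3
    theta). An increment of beta^theta is at most J beta^(theta-1) times that of beta; so a factor
    (k beta_k/a_k^3)^(theta-1) splits off, which [ratio_bounded] controls, and W_{k+1} (p_k -
    p_{k+1}) remains. *)
Lemma moment_series_bounded :
  bsum (fun k => tau k * (k%:R * beta k / a k ^+ 3) `^ theta).
Proof.
have [n0 [B hB]] := ratio_bounded.
have [J hJ] : exists J : nat, theta <= J%:R.
  exists (Num.bound theta); exact/ltW/archi_boundP/(le_trans ler01 th1).
have [n2 hn2] : exists n2 : nat, N <= n2%:R.
  exists (Num.bound `|N|); apply: (le_trans (ler_norm _)); exact/ltW/archi_boundP.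
have th0 : 0 < theta by exact: lt_le_trans th1.
have [M WM] := sum_Wdp.
pose n1 := maxn n0 (maxn n2 1).
have n11 : (1 <= n1)%N by rewrite /n1 !leq_max leqnn !orbT.
have n01 : (n0 <= n1)%N by rewrite leq_maxl.
have Nn n : (n1 <= n)%N -> N <= n%:R.
  by move=> nn; apply: (le_trans hn2); rewrite ler_nat (leq_trans _ nn)// /n1 !leq_max leqnn ?orbT.
pose g k := k%:R `^ theta * tau k / a k `^ (3 * theta).
have B0 : 0 <= B.
  by apply: le_trans (hB n1 _ n11); [exact: powR_ge0|exact: n01].
have a3 k th : (1 <= k)%N -> a k `^ (3 * th) = (a k ^+ 3) `^ th.
  by move=> k1; rewrite powRrM -powR_mulrn// ltW// a0.
have E3 k th : (1 <= k)%N -> (k%:R * beta k / a k ^+ 3) `^ th =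
    k%:R `^ th * beta k `^ th / a k `^ (3 * th).
  move=> k1; have ak := exprn_gt0 3 (a0 k1).
  rewrite a3//; apply: (mulIf (lt0r_neq0 (powR_gt0 th ak))).
  have e0 : 0 <= k%:R * beta k / a k ^+ 3 by apply: divr_ge0; [apply: mulr_ge0 => //; exact: be0|exact: ltW].
  rewrite divfK ?gt_eqF ?powR_gt0// -(powRM _ e0 (ltW ak)).
  by rewrite divfK ?gt_eqF// powRM// be0.
have gE k : (1 <= k)%N -> tau k * (k%:R * beta k / a k ^+ 3) `^ theta = g k * beta k `^ theta.
  by move=> k1; rewrite E3// /g; ring.
have G k m : (n1 <= k)%N -> \sum_(k <= n < m) g n <= C * W k * (k%:R `^ (theta - 1) / a k `^ (3 * theta)).
  move=> nk; have k1 := leq_trans n11 nk.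
  have kk : 0 < k%:R `^ (theta - 1) :> R by rewrite powR_gt0// ltr0n.
  have ak : 0 < a k `^ (3 * theta) by rewrite powR_gt0// a0.
  have := hC m k1 (Nn _ nk).
  by rewrite -/(g _) mulrA mulrAC ler_pdivrMr// mulrC ler_pdivlMr//; rewrite mulrC [X in _ <= X]mulrC.
pose K := beta n1 `^ theta * (C * W n1 * (n1%:R `^ (theta - 1) / a n1 `^ (3 * theta))) + J%:R * C * B * D * M.
have JCBD : 0 <= J%:R * C * B * D by rewrite !mulr_ge0// ltW.
have S0 : 0 <= M by apply: le_trans (WM 0%N); rewrite big_geq.
(* The maximum with 0 covers the empty sums, those with m < n1. *)
apply: (@bsum_tail _ _ n1 (Num.max K 0)) => // m.
have [nm|nm] := leqP n1 m; last by rewrite big_geq ?le_max ?lexx ?orbT// ltnW.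
rewrite le_max; apply/orP; left.
rewrite (eq_big_nat _ _ (F2 := fun k => g k * beta k `^ theta)); last first.
  by move=> k /andP[nk _]; rewrite gE//; exact: leq_trans nk.
rewrite -(subnKC nm) abel_sum; apply: lerD.
  by rewrite ler_wpM2l ?powR_ge0// G.
apply: (@le_trans _ _ (\sum_(n1 <= k < n1 + (m - n1)) J%:R * C * B * D * (W k.+1 * (p k - p k.+1)))).
  apply: ler_sum_nat => k /andP[nk km].
  have k1 := leq_trans n11 nk.
  have h1 := powR_sub_le (be0 k1) (beI k1) th0 hJ.
  have h2 := G k.+1 (n1 + (m - n1))%N (leqW nk).
  have ak := a0 (isT : (1 <= k.+1)%N).
  have h3 : 0 <= beta k.+1 `^ theta - beta k `^ theta.
    by rewrite subr_ge0 ge0_ler_powR ?nnegrE ?be0 ?beI// ltW.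
  have g0 : 0 <= C * W k.+1 * (k.+1%:R `^ (theta - 1) / a k.+1 `^ (3 * theta)).
    by rewrite !mulr_ge0 ?invr_ge0 ?powR_ge0// ltW.
  apply: (le_trans (ler_wpM2l h3 h2)); apply: (le_trans (ler_wpM2r g0 h1)).
  have a3E : a k.+1 `^ (3 * theta) = a k.+1 `^ (3 * (theta - 1)) * a k.+1 ^+ 3.
    by rewrite !a3// (powR_predr theta (exprn_gt0 3 ak)).
  have h4 := hB k.+1 (leq_trans n01 (leqW nk)) isT; rewrite E3// in h4.
  have h5 := beD k1.
  have ap : 0 < a k.+1 `^ (3 * (theta - 1)) by rewrite powR_gt0.
  have ap3 : 0 < a k.+1 ^+ 3 by rewrite exprn_gt0.
  have -> : J%:R * beta k.+1 `^ (theta - 1) * (beta k.+1 - beta k) *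
      (C * W k.+1 * (k.+1%:R `^ (theta - 1) / a k.+1 `^ (3 * theta))) =
      (J%:R * C * W k.+1) * ((k.+1%:R `^ (theta - 1) * beta k.+1 `^ (theta - 1) / a k.+1 `^ (3 * (theta - 1)))
       * ((beta k.+1 - beta k) / a k.+1 ^+ 3)).
    by rewrite a3E; field; rewrite !gt_eqF.
  have -> : J%:R * C * B * D * (W k.+1 * (p k - p k.+1)) =
     (J%:R * C * W k.+1) * (B * (D * (p k - p k.+1))) by ring.
  rewrite ler_wpM2l//; first by rewrite !mulr_ge0// ltW.
  apply: ler_pM => //.
  - by rewrite !mulr_ge0 ?invr_ge0 ?powR_ge0.
  - by rewrite divr_ge0 ?subr_ge0 ?beI// ltW.
  - by rewrite ler_pdivrMr// mulrAC.
rewrite -mulr_sumr ler_wpM2l//; apply: (le_trans _ (WM (n1 + (m - n1))%N)).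
rewrite [leRHS](@big_cat_nat _ _ _ n1)//=; last exact: leq_addr.
rewrite lerDr big_nat_cond sumr_ge0// => j /andP[/andP[j1 _] _]; exact: Wdp0.
Qed.

End tail_condition.

(** * Truncation *)

Section truncation.
Context {d : measure_display} {T : measurableType d} {R : realType}
  (P : probability T R) (X : nat -> {RV P >-> R}).
Hypothesis iidX : iid X.

Definition trunc (b v : R) : R := v * (if `|v| < b then 1 else 0).

Lemma measurable_trunc b : measurable_fun setT (trunc b).
Proof.
apply: measurable_funM; first exact: measurable_id.
apply: measurable_fun_ifT; [|exact: measurable_cst|exact: measurable_cst].
by apply: measurable_fun_ltr; [exact: normr_measurable|exact: measurable_cst].
Qed.

Lemma trunc_le b v : 0 < b -> `|trunc b v| <= b.
Proof.
by move=> b0; rewrite /trunc; case: ifP => [/ltW|_]; rewrite ?mulr1// mulr0 normr0 ltW.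
Qed.

Lemma trunc_id b v : `|v| < b -> trunc b v = v.
Proof. by rewrite /trunc => ->; rewrite mulr1. Qed.

Definition trX b := compRV X (measurable_trunc b).

Lemma iid_trX b : iid (trX b).
Proof. exact: iid_comp. Qed.

Lemma trX_le b : 0 < b -> forall i x, `|trX b i x| <= b.
Proof. by move=> b0 i x; exact: trunc_le. Qed.

Definition tail c := Pr P [set w | c <= `|X 0%N w|].
Definition third b := EV P (fun x => `|trX b 0%N x| ^+ 3).

Lemma mXi i : measurable_fun setT (X i).
Proof. exact: measurable_funPT. Qed.

Lemma mXge i c : measurable [set w | c <= `|X i w|].
Proof. exact: measurable_norm_ge (mXi i). Qed.

Lemma tail_ge0 c : 0 <= tail c.
Proof. exact: Pr_ge0. Qed.

Lemma tailE i c : Pr P [set w | c <= `|X i w|] = tail c.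
Proof.
have mB : measurable [set v : R | c <= `|v|] by apply: measurable_norm_ge; exact: measurable_id.
rewrite /tail /Pr; congr fine; exact: (iidX.2 i _ mB).
Qed.

Lemma le_tail c c' : c <= c' -> tail c' <= tail c.
Proof. by move=> cc; apply: le_Pr; [exact: mXge|exact: mXge|move=> w; exact: le_trans]. Qed.

Lemma bm_trX b i : 0 < b -> bm (trX b i).
Proof. by move=> b0; exact: (bm_RV (trX_le b0)). Qed.

Lemma third_ge0 b : 0 <= third b.
Proof. by apply: EV_ge0 => x; rewrite exprn_ge0. Qed.

Lemma le_third b b' : 0 < b -> b <= b' -> third b <= third b'.
Proof.
move=> b0 bb; have b'0 := lt_le_trans b0 bb.
have bt := bm_trX 0 b0; have bt' := bm_trX 0 b'0.
apply: EV_le; [bmt|bmt|] => x /=; rewrite lerXn2r ?nnegrE// /trunc.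
case: ltP => h; first by rewrite (lt_le_trans h bb).
by rewrite mulr0 normr0.
Qed.

(** Only the values b <= |X_1| < b' contribute, and there the cube is at most b'^3. *)
Lemma third_sub_le b b' : 0 < b -> b <= b' ->
  third b' - third b <= b' ^+ 3 * (tail b - tail b').
Proof.
move=> b0 bb; have b'0 := lt_le_trans b0 bb.
have bt := bm_trX 0 b0; have bt' := bm_trX 0 b'0.
have bi1 := bm_indic (R := R) (mXge 0 b); have bi2 := bm_indic (R := R) (mXge 0 b').
rewrite /tail -!EV_indic; [|exact: mXge|exact: mXge].
rewrite -EV_sub; [|bmt|bmt].
rewrite -EV_sub; [|bmt|bmt].
rewrite -EV_scale; last bmt.
apply: EV_le; [bmt|bmt|] => x /=.
have inE' c : \1_[set w | c <= `|X 0%N w|] x = (if c <= `|X 0%N x| then 1 else 0) :> R.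
  by rewrite indicE; case: ifP => h; [rewrite mem_set|rewrite memNset//= h].
rewrite !inE' /trunc.
have [h|h] := ltP `|X 0%N x| b.
  have hb' := lt_le_trans h bb.
  by rewrite ?hb' ?(leNgt b') ?hb' ?(leNgt b) ?h /= !subrr mulr0.
have [h'|h'] := ltP `|X 0%N x| b'.
  rewrite mulr1 mulr0 normr0 expr0n /= !subr0 mulr1.
  by rewrite lerXn2r ?nnegrE// ?(ltW h')// ltW.
by rewrite !mulr0 normr0 expr0n /= !subrr mulr0.
Qed.

Lemma mSn n : measurable_fun setT (fun w => \sum_(i < n) X i w).
Proof. by apply: measurable_sum => i; exact: mXi. Qed.

(** Passage between a sum and its truncation, in either direction: they coincide unless some |X_i|
    >= b with i < n, and a union bound pays for that. *)
Lemma Pr_le_trunc (A B : set T) (n : nat) b : measurable A -> measurable B ->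
  (forall w, A w -> (forall i, (i < n)%N -> `|X i w| < b) -> B w) ->
  Pr P A <= Pr P B + n%:R * tail b.
Proof.
move=> mA mB AB.
have bA := bm_indic (R := R) mA; have bB := bm_indic (R := R) mB.
have bI i := bm_indic (R := R) (mXge i b).
have -> : n%:R * tail b = EV P (fun w => \sum_(i < n) \1_[set w | b <= `|X i w|] w).
  rewrite EV_sum//; under eq_bigr do rewrite (EV_indic _ (mXge _ _)) tailE.
  by rewrite sumr_const card_ord mulr_natl.
have bS : bm (fun w => \sum_(i < n) \1_[set w | b <= `|X i w|] w : R) by apply: bm_sum => i.
rewrite -!EV_indic// -EV_add//; apply: EV_le => //; first by bmt.
move=> w; have S0 : 0 <= \sum_(i < n) \1_[set w | b <= `|X i w|] w :> R.
  by apply: sumr_ge0 => i _; rewrite indicE ler0n.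
rewrite !indicE; have [wA|wA] := boolP (w \in A); last by rewrite addr_ge0.
have [wB|wB] := boolP (w \in B); first by rewrite lerDl.
rewrite add0r; have [[i bi]|] := pselect (exists i : 'I_n, b <= `|X i w|).
  rewrite (bigD1 i)//= indicE mem_set// lerDl.
  by apply: sumr_ge0 => j _; rewrite indicE ler0n.
move/forallNP => h; exfalso; move: wB; rewrite notin_setE; apply.
apply: AB; first exact/set_mem.
by move=> i ni; rewrite ltNge; apply/negP; exact: (h (Ordinal ni)).
Qed.

Lemma trunc_second_momentE a eps n :
  trunc_second_moment X a eps n = EV P (fun x => trX (eps * a n) 0%N x ^+ 2).
Proof.
rewrite /trunc_second_moment /EV /Rintegral unlock; congr fine.
apply: eq_integral => x _; rewrite /= /trunc exprMn; congr (_ * _)%:E.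
by case: ifP => _; rewrite ?expr1n ?expr0n.
Qed.

Lemma centered_tail (theta eps : R) (a : nat -> R) n : 0 < eps -> 0 < a n ->
  1 <= theta -> (0 < n)%N ->
  Pr P [set w | 4 * theta * (eps * a n) <=
    `|\sum_(i < n) trX (eps * a n) i w - n%:R * EV P (trX (eps * a n) 0%N)|] <=
  2 * expR (27 * 27) * (exp_term X a eps n + (n%:R * third (eps * a n) / (eps * a n) ^+ 3) `^ theta).
Proof.
move=> e0 an th1 n0; set b := eps * a n; have b0 : 0 < b by exact: mulr_gt0.
have mo : measurable_fun setT (fun v : R => - v) by exact: oppr_measurable.
pose Y := trX b; pose Y' := compRV Y mo.
have iY : iid Y by exact: iid_trX.
have iY' : iid Y' by exact: iid_comp.
have Yb := trX_le b0.
have Yb' i x : `|Y' i x| <= b by rewrite /= normrN; exact: Yb.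
have h1 := upper_tail iY Yb b0 th1 n0.
have h2 := upper_tail iY' Yb' b0 th1 n0.
have bY := bm_trX 0 b0.
have e1 : EV P (Y' 0%N) = - EV P (Y 0%N) by rewrite -EV_opp.
have e2 : EV P (fun x => Y' 0%N x ^+ 2) = EV P (fun x => Y 0%N x ^+ 2).
  by congr EV; apply/funext => x /=; rewrite sqrrN.
have e3 : EV P (fun x => `|Y' 0%N x| ^+ 3) = third b.
  by congr EV; apply/funext => x /=; rewrite normrN.
have e4 : (if EV P (fun x => Y 0%N x ^+ 2) == 0 then 0 else
    expR (- b ^+ 2 / (n%:R * EV P (fun x => Y 0%N x ^+ 2)))) = exp_term X a eps n.
  by rewrite /exp_term trunc_second_momentE -/b -/Y; case: ifP => // _; rewrite /b exprMn.
rewrite e1 e2 e3 e4 in h2; rewrite -/(third b) e4 in h1.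
have mS : measurable_fun setT (fun w => \sum_(i < n) Y i w).
  by apply: measurable_sum => i; exact: measurable_funPT.
have mS' : measurable_fun setT (fun w => \sum_(i < n) Y' i w).
  by apply: measurable_sum => i; exact: measurable_funPT.
set A := [set w | _ <= \sum_(i < n) Y i w] in h1.
set A' := [set w | _ <= \sum_(i < n) Y' i w] in h2.
have mA : measurable A by exact: measurable_set_le.
have mA' : measurable A' by exact: measurable_set_le.
apply: (@le_trans _ _ (Pr P (A `|` A'))); last first.
  apply: (le_trans (Pr_setU P mA mA')); apply: (le_trans (lerD h1 h2)).
  by rewrite -mulrA; lra.
apply: le_Pr; [|exact: measurableU|].
  apply: measurable_norm_ge; apply: measurable_funD => //; exact: measurable_cst.
move=> w /=; rewrite /A /A' /= -/Y sumrN.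
have [s0|s0] := leP 0 (\sum_(i < n) Y i w - n%:R * EV P (Y 0%N)).
  by rewrite ger0_norm// => ?; left; lra.
by rewrite ltr0_norm// => ?; right; lra.
Qed.

(** If S_n is within 4 theta b of n mu with probability above 1/2, so is every median; then |n mu|
    <= (4 theta + 1) b, and |S_n| >= (8 theta + 1) b leaves a deviation of 4 theta b from n mu.
    Otherwise the right-hand side is at least 1. *)
Lemma sum_tail_le (theta eps : R) (a : nat -> R) n m : 0 < eps -> 0 < a n ->
  1 <= theta -> (0 < n)%N -> is_median P (partial_sum X n) m -> `|m| <= eps * a n ->
  Pr P [set w | (8 * theta + 1) * (eps * a n) <= `|partial_sum X n w|] <=
  4 * expR (27 * 27) * (exp_term X a eps n + (n%:R * third (eps * a n) / (eps * a n) ^+ 3) `^ theta)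
  + 2 * (n%:R * tail (eps * a n)).
Proof.
move=> e0 an th1 n0 [med1 med2] mb; have cen := centered_tail e0 an th1 n0.
set b := eps * a n in mb cen *; have b0 : 0 < b by exact: mulr_gt0.
have mS : measurable_fun setT (partial_sum X n) by exact: mSn.
rewrite [P _]PrE in med1; last exact: measurable_set_le.
rewrite [P _]PrE in med2; last exact: measurable_set_le.
rewrite !lee_fin in med1 med2.
set mu := EV P (trX b 0%N) in cen.
set A := [set w | _ <= `|partial_sum X n w|].
have mA : measurable A by exact: measurable_norm_ge.
pose B := [set w | 4 * theta * b <= `|partial_sum X n w - n%:R * mu|].
have mB : measurable B.
  by apply: measurable_norm_ge; apply: measurable_funD => //; exact: measurable_cst.
set V := [set w | 4 * theta * b <= _] in cen.
have mV : measurable V.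
  apply: measurable_norm_ge; apply: measurable_funD; last exact: measurable_cst.
  by apply: measurable_sum => i; exact: measurable_funPT.
have BV : Pr P B <= Pr P V + n%:R * tail b.
  apply: Pr_le_trunc => // w; rewrite /B /V /= => h Xb.
  rewrite (eq_bigr (fun i : 'I_n => X i w))// => i _ /=; rewrite trunc_id//; exact: Xb.
set E := exp_term _ _ _ _ + _ in cen *.
have [h|h] := leP 2^-1 (Pr P V + n%:R * tail b).
  by apply: (le_trans (Pr_le1 P mA)); lra.
have B2 : Pr P B < 2^-1 by exact: le_lt_trans h.
have s1 : m < n%:R * mu + 4 * theta * b.
  rewrite ltNge; apply/negP => h1.
  have : Pr P [set w | m <= partial_sum X n w] <= Pr P B.
    apply: le_Pr => //; first exact: measurable_set_le.
    by move=> w /= h2; rewrite /B /= ler_normr; apply/orP; left; lra.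
  lra.
have s2 : n%:R * mu - 4 * theta * b < m.
  rewrite ltNge; apply/negP => h1.
  have : Pr P [set w | partial_sum X n w <= m] <= Pr P B.
    apply: le_Pr => //; first exact: measurable_set_le.
    by move=> w /= h2; rewrite /B /= ler_normr; apply/orP; right; lra.
  lra.
have AB : Pr P A <= Pr P B.
  apply: le_Pr => // w; rewrite /A /B /= => h1.
  move: mb; rewrite ler_norml => /andP[m1 m2].
  by move: h1; rewrite !ler_normr => /orP[h1|h1]; apply/orP; [left|right]; lra.
have E0 : 0 <= n%:R * tail b by rewrite mulr_ge0// tail_ge0.
have : 0 <= Pr P V by exact: Pr_ge0.
by move: cen; lra.
Qed.

End truncation.

(** * Exponential lower bound *)

Section exponential_lower_bound.
Context {d : measure_display} {T : measurableType d} {R : realType}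
  (P : probability T R).

Lemma expRM_powR (x t : R) : expR (x * t) = expR x `^ t.
Proof. by rewrite /powR gt_eqF ?expR_gt0// expRK mulrC. Qed.

Lemma expRN_le_min (y : R) : 0 < y -> expR (- y) <= Num.min 1 y^-1.
Proof.
move=> y0; rewrite le_min; apply/andP; split; first by rewrite -expR0 ler_expR; lra.
rewrite expRN lef_pV2 ?posrE ?expR_gt0//; have := expR_ge1Dx y; lra.
Qed.

(** Write the left side as (e^(-y))^(3 theta) with y = eps^2/(3 theta u). Then e^(-y) <= min(1, 1/y)
    is at most a multiple of min(u, 1), whose cube the hypothesis controls. *)
Lemma expRN_le_powR (eps u theta c e3 : R) : 0 < eps -> 0 < u -> 1 <= theta -> 0 <= c -> 0 <= e3 ->
  (Num.min u 1) ^+ 3 <= c * e3 ->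
  expR (- (eps ^+ 2 / u)) <= ((1 + 3 * theta / eps ^+ 2) ^+ 3 * c) `^ theta * e3 `^ theta.
Proof.
move=> e0 u0 th1 c0 e30 h; have e20 : 0 < eps ^+ 2 by rewrite exprn_gt0.
set y := eps ^+ 2 / (3 * theta * u).
have tu : 0 < 3 * theta * u by rewrite !mulr_gt0//; lra.
have y0 : 0 < y by rewrite divr_gt0.
have -> : - (eps ^+ 2 / u) = (3 * - y) * theta.
  by rewrite /y; field; rewrite !gt_eqF//; lra.
set K := 1 + 3 * theta / eps ^+ 2.
have t3 : 0 <= 3 * theta / eps ^+ 2 by rewrite divr_ge0 ?(ltW e20)//; lra.
have K1 : 1 <= K by rewrite /K lerDl.
rewrite expRM_powR -powRM//; last by rewrite mulr_ge0 ?exprn_ge0//; lra.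
have th0 : 0 <= theta by lra.
apply: ge0_ler_powR; rewrite ?nnegrE ?expR_ge0// ?mulr_ge0// ?exprn_ge0//; try lra.
rewrite expRM_natl -mulrA; apply: (@le_trans _ _ (K ^+ 3 * Num.min u 1 ^+ 3)); last first.
  by rewrite ler_wpM2l// exprn_ge0//; lra.
have mu0 : 0 <= Num.min u 1 by rewrite le_min ler01 ltW.
rewrite -exprMn lerXn2r ?nnegrE ?expR_ge0// ?mulr_ge0//; first lra.
apply: (le_trans (expRN_le_min y0)).
have yV : y^-1 = 3 * theta / eps ^+ 2 * u by rewrite /y invf_div; ring.
rewrite /Num.min; case: ifP => h1; case: ifP => h2; rewrite ?yV /K; try nra.
Qed.

Variables (Y : nat -> {RV P >-> R}) (b : R).
Hypotheses (iidY : iid Y) (Yb : forall i x, `|Y i x| <= b).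
Let mu := EV P (Y 0%N).
Let T2 := EV P (fun x => Y 0%N x ^+ 2).
Let Q := EV P (fun x => Y 0%N x ^+ 4).

Lemma sqr_second_le_fourth : T2 ^+ 2 <= Q.
Proof.
have bY := bm_RV Yb 0.
have : 0 <= EV P (fun x => (Y 0%N x ^+ 2 - T2) ^+ 2) by apply: EV_ge0 => x; exact: sqr_ge0.
have -> : EV P (fun x => (Y 0%N x ^+ 2 - T2) ^+ 2) =
    EV P (fun x => Y 0%N x ^+ 4 - (2 * T2 * Y 0%N x ^+ 2 - T2 ^+ 2)).
  by congr EV; apply/funext => x; ring.
rewrite EV_sub; [|bmt|bmt].
rewrite EV_sub; [|bmt|bmt].
rewrite EV_scale; last bmt.
by rewrite EV_cst -/T2 -/Q; lra.
Qed.

(** Take k + 1 blocks of m = n/(k+1) variables, rounded down. The level reached has square (k+1)^2 m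
    T2/100^2 >= (k+1) n T2/(2 * 100^2), and k + 1 >= eps^2 A^2/(1600 n T2); this dictates the
    condition on [L]. For the probability, 1600^(-k) >= e^(-1600 k). *)
Lemma exp_le_sum_tail (A eps L : R) (n k : nat) : 0 < A -> 0 < eps -> (0 < n)%N ->
  0 < L -> 2 * 100 ^+ 2 * (40 * 40) <= L ^+ 2 -> 0 <= mu -> 0 < T2 ->
  k%:R <= eps ^+ 2 / (n%:R * T2 / A ^+ 2) / (40 * 40) ->
  eps ^+ 2 / (n%:R * T2 / A ^+ 2) / (40 * 40) <= k.+1%:R ->
  2 * k.+1%:R * Q <= n%:R * T2 ^+ 2 ->
  expR (- (eps ^+ 2 / (n%:R * T2 / A ^+ 2))) <=
    40 * 40 * Pr P [set w | eps / L * A <= \sum_(i < n) Y i w].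
Proof.
have [q qE] : exists q : R, q = 40 * 40 by exists (40 * 40).
have [h hE] : exists h : R, h = 100 by exists 100.
have h0 : 0 < h by rewrite hE.
have q0 : 0 < q by rewrite qE mulr_gt0.
have Bl := @blocks_lower _ _ _ _ Y b iidY Yb.
rewrite -hE -qE -/mu -/T2 -/Q in Bl * => A0 e0 n0 L0 Lq mu0 T0 k1 k2 kQ.
set u := n%:R * T2 / A ^+ 2 in k1 k2 *.
have nR : 0 < n%:R :> R by rewrite ltr0n.
have A20 : 0 < A ^+ 2 by rewrite exprn_gt0.
have u0 : 0 < u by rewrite divr_gt0// mulr_gt0.
have T20 : 0 < T2 ^+ 2 by rewrite exprn_gt0.
have TQ := sqr_second_le_fourth.
have kR : 0 < k.+1%:R :> R by rewrite ltr0n.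
(* Since T2^2 <= Q, the fourth-moment hypothesis forces n to be large, so the blocks are
   nonempty. *)
have kn : (2 * k.+1 <= n)%N.
  rewrite -(ler_nat R) natrM -(ler_pM2r T20); apply: le_trans kQ.
  by rewrite ler_pM2l// mulr_gt0.
pose m := (n %/ k.+1)%N.
have m0 : (0 < m)%N by rewrite divn_gt0// (leq_trans _ kn)// leq_pmull.
have mk : (k.+1 * m <= n)%N by rewrite mulnC leq_trunc_div.
have nm : (n <= 2 * (k.+1 * m))%N.
  apply: (leq_trans (ltnW (ltn_ceil n (isT : (0 < k.+1)%N)))); rewrite -/m.
  by rewrite (mulnC k.+1) mulnA leq_mul2r mul2n -addnn -[m.+1]addn1 leq_add2l m0 orbT.
have nmR : n%:R <= 2 * (k.+1%:R * m%:R) :> R by rewrite -!natrM ler_nat.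
have Qm : Q <= m%:R * T2 ^+ 2.
  rewrite -(ler_pM2l (mulr_gt0 (ltr0Sn R 1) kR)); apply: (le_trans kQ).
  rewrite (_ : 2 * k.+1%:R * (m%:R * T2 ^+ 2) = 2 * (k.+1%:R * m%:R) * T2 ^+ 2); last by ring.
  by rewrite ler_pM2r.
have := Bl m k (iota 0 n) m0 Qm mu0 T0 (iota_uniq _ _).
rewrite size_iota => /(_ mk).
set c := k.+1%:R * _.
have -> : [set w | c <= \sum_(i <- iota 0 n) Y i w] = [set w | c <= \sum_(i < n) Y i w].
  by apply/seteqP; split=> w /=; rewrite -(big_mkord xpredT (fun i => Y i w)) /index_iota subn0.
move=> B1.
have mS : measurable_fun setT (fun w => \sum_(i < n) Y i w).
  by apply: measurable_sum => i; exact: measurable_funPT.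
have cA : eps / L * A <= c.
  rewrite /c mulrA ler_pdivlMr//.
  have mT0 : 0 <= m%:R * T2 by rewrite mulr_ge0// ltW.
  rewrite -ler_sqr ?nnegrE; last 2 first.
  - by rewrite mulr_ge0 ?(ltW h0)// mulr_ge0 ?(ltW A0)// divr_ge0 ?(ltW e0)// ltW.
  - by rewrite mulr_ge0// sqrtr_ge0.
  rewrite [X in _ <= X]exprMn sqr_sqrtr// !exprMn exprVn.
  have uE : n%:R * T2 = u * A ^+ 2 by rewrite /u divfK// gt_eqF.
  have k2' : eps ^+ 2 <= k.+1%:R * q * u.
    by move: k2; rewrite ler_pdivrMr// ler_pdivrMr.
  have L20 : 0 < L ^+ 2 by rewrite exprn_gt0.
  rewrite mulrAC -mulrA mulrAC mulrA ler_pdivrMr//.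
  have s1 : eps ^+ 2 * h ^+ 2 * A ^+ 2 <= k.+1%:R * q * u * (h ^+ 2 * A ^+ 2).
    by rewrite -mulrA ler_wpM2r// mulr_ge0// ?exprn_ge0 ?(ltW A20)// ltW.
  have s2 : k.+1%:R * (n%:R * T2) * (h ^+ 2 * q) <= k.+1%:R * (2 * (k.+1%:R * m%:R) * T2) * (h ^+ 2 * q).
    by rewrite ler_wpM2r ?mulr_ge0 ?exprn_ge0 ?(ltW q0) ?(ltW h0)// ler_wpM2l// ler_wpM2r// ltW.
  have s3 : k.+1%:R ^+ 2 * (m%:R * T2) * (2 * h ^+ 2 * q) <= k.+1%:R ^+ 2 * (m%:R * T2) * L ^+ 2.
    by rewrite ler_wpM2l// mulr_ge0// exprn_ge0.
  rewrite uE in s2; lra.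
apply: (@le_trans _ _ (q * q^-1 ^+ k.+1)); last first.
  rewrite ler_pM2l//; apply: (le_trans B1); apply: le_Pr => //.
  - exact: measurable_set_le.
  - exact: measurable_set_le.
  - by move=> w /=; exact: le_trans.
rewrite (exprS q^-1) mulrA divff ?gt_eqF// mul1r expRN exprVn lef_pV2 ?posrE ?expR_gt0 ?exprn_gt0//.
apply: (@le_trans _ _ (expR q ^+ k)).
  by rewrite lerXn2r ?nnegrE ?expR_ge0 ?(ltW q0)//; have := expR_ge1Dx q; lra.
by rewrite -expRM_natl ler_expR; move: k1; rewrite ler_pdivlMr// .
Qed.

(** With e3 = n beta/A^3 the failure of the fourth-moment condition gives u^2 <= 2 (k+1) eps e3. One
    more factor u replaces k by k u <= eps^2/1600, so min(u, 1)^3 is at most a multiple of e3. *)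
Lemma exp_le_third (A eps beta theta : R) (n k : nat) : 0 < A -> 0 < eps -> (0 < n)%N ->
  1 <= theta -> 0 < T2 -> Q <= eps * A * beta ->
  k%:R <= eps ^+ 2 / (n%:R * T2 / A ^+ 2) / (40 * 40) ->
  n%:R * T2 ^+ 2 < 2 * k.+1%:R * Q -> 0 <= beta ->
  expR (- (eps ^+ 2 / (n%:R * T2 / A ^+ 2))) <=
    ((1 + 3 * theta / eps ^+ 2) ^+ 3 * (2 * eps * (eps ^+ 2 / (40 * 40) + 1))) `^ theta *
    (n%:R * beta / A ^+ 3) `^ theta.
Proof.
have [q qE] : exists q : R, q = 40 * 40 by exists (40 * 40).
have q0 : 0 < q by rewrite qE mulr_gt0.
rewrite -qE => A0 e0 n0 th1 T0 Qb k1 kQ be0.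
set u := n%:R * T2 / A ^+ 2 in k1 *; set e3 := n%:R * beta / A ^+ 3.
have nR : 0 < n%:R :> R by rewrite ltr0n.
have A20 : 0 < A ^+ 2 by rewrite exprn_gt0.
have A30 : 0 < A ^+ 3 by rewrite exprn_gt0.
have u0 : 0 < u by rewrite divr_gt0// mulr_gt0.
have e30 : 0 <= e3 by rewrite divr_ge0 ?(ltW A30)// mulr_ge0.
have e20 : 0 < eps ^+ 2 by rewrite exprn_gt0.
have eq0 : 0 < eps ^+ 2 / q by rewrite divr_gt0.
apply: expRN_le_powR => //; first by rewrite !mulr_ge0//; lra.
have hu : u ^+ 2 <= 2 * k.+1%:R * eps * e3.
  have -> : u ^+ 2 = n%:R * (n%:R * T2 ^+ 2) / A ^+ 4 by rewrite /u; field; rewrite gt_eqF.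
  have A40 : 0 < A ^+ 4 by rewrite exprn_gt0.
  rewrite ler_pdivrMr//.
  have -> : 2 * k.+1%:R * eps * e3 * A ^+ 4 = n%:R * (2 * k.+1%:R * (eps * A * beta)).
    by rewrite /e3; field; rewrite gt_eqF.
  rewrite ler_pM2l//; apply: (le_trans (ltW kQ)).
  by rewrite ler_wpM2l// mulr_ge0.
have ku : k%:R * u <= eps ^+ 2 / q.
  by move: k1; rewrite mulrAC ler_pdivlMr.
have k1E : k.+1%:R = k%:R + 1 :> R by rewrite -addn1 natrD.
have ee : 0 <= 2 * eps * e3 by apply: mulr_ge0 => //; apply: mulr_ge0 => //; exact: ltW.
have hu3 : u ^+ 3 <= 2 * eps * (eps ^+ 2 / q + u) * e3.
  have : u * u ^+ 2 <= u * (2 * k.+1%:R * eps * e3) by rewrite ler_wpM2l// ltW.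
  rewrite -exprS k1E => h; apply: (le_trans h).
  have := ler_wpM2r ee ku; lra.
rewrite /Num.min; case: ifP => [u1|/negbT]; last rewrite -leNgt => u1.
  apply: (le_trans hu3); have := ler_wpM2l ee (ltW u1); lra.
rewrite expr1n.
(* For u >= 1 the sum eps^2/q + u is at most u (eps^2/q + 1); the common factor u cancels and u^2 >=
   1 remains. *)
have h1 : u * u ^+ 2 <= u * (2 * eps * (eps ^+ 2 / q + 1) * e3).
  rewrite -exprS; apply: (le_trans hu3).
  have h2 : eps ^+ 2 / q <= u * (eps ^+ 2 / q) by rewrite ler_peMl// ltW.
  have := ler_wpM2l ee h2; lra.
rewrite ler_pM2l// in h1; apply: le_trans h1.
by rewrite expr2; nra.
Qed.

End exponential_lower_bound.

(** * Lower bounds for the tail of the sum *)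

Section lower_estimates.
Context {d : measure_display} {T : measurableType d} {R : realType}
  (P : probability T R) (X : nat -> {RV P >-> R}).
Hypothesis iidX : iid X.

Lemma exp_term_le (theta eps : R) (a : nat -> R) n : 0 < eps -> 0 < a n ->
  1 <= theta -> (0 < n)%N ->
  exp_term X a eps n <=
    40 * 40 * (Pr P [set w | eps / (100 * 60) * a n <= `|partial_sum X n w|]
               + n%:R * tail X (eps * a n)) +
    ((1 + 3 * theta / eps ^+ 2) ^+ 3 * (2 * eps * (eps ^+ 2 / (40 * 40) + 1))) `^ theta *
    (n%:R * third X (eps * a n) / a n ^+ 3) `^ theta.
Proof.
move=> e0 an th1 n0; set b := eps * a n; have b0 : 0 < b by exact: mulr_gt0.
set S := [set w | _ <= `|partial_sum X n w|].
have mS : measurable S by exact: measurable_norm_ge (mSn _ _).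
set K := ((1 + 3 * theta / eps ^+ 2) ^+ 3 * _) `^ theta.
have rhs1 : 0 <= 40 * 40 * (Pr P S + n%:R * tail X b).
  by apply: mulr_ge0; [exact: mulr_ge0|apply: addr_ge0; [exact: Pr_ge0|apply: mulr_ge0 => //; exact: tail_ge0]].
have rhs2 : 0 <= K * (n%:R * third X b / a n ^+ 3) `^ theta by apply: mulr_ge0; exact: powR_ge0.
rewrite /exp_term trunc_second_momentE -/b.
case: ifPn => [_|T2n]; first exact: addr_ge0.
(* [Y] will be the truncation or its negative, whichever has nonnegative mean. *)
have core (Y : nat -> {RV P >-> R}) : iid Y -> (forall i x, `|Y i x| <= b) ->
    EV P (fun x => Y 0%N x ^+ 2) = EV P (fun x => trX X b 0%N x ^+ 2) ->
    (forall x, `|Y 0%N x| = `|trX X b 0%N x|) ->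
    0 <= EV P (Y 0%N) ->
    (forall w, eps / (100 * 60) * a n <= \sum_(i < n) Y i w ->
       eps / (100 * 60) * a n <= `|\sum_(i < n) trX X b i w|) ->
  expR (- (eps ^+ 2 * a n ^+ 2) / (n%:R * EV P (fun x => trX X b 0%N x ^+ 2))) <=
    40 * 40 * (Pr P S + n%:R * tail X b) + K * (n%:R * third X b / a n ^+ 3) `^ theta.
  move=> iY Yb TE YE mu0 YS; have bY := bm_RV Yb 0.
  rewrite -TE in T2n *; set T2 := EV P (fun x => Y 0%N x ^+ 2) in T2n TE *.
  have T20 : 0 < T2 by rewrite lt_def T2n EV_ge0// => x; exact: sqr_ge0.
  have nR : 0 < n%:R :> R by rewrite ltr0n.
  have a20 : 0 < a n ^+ 2 by rewrite exprn_gt0.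
  have -> : - (eps ^+ 2 * a n ^+ 2) / (n%:R * T2) = - (eps ^+ 2 / (n%:R * T2 / a n ^+ 2)).
    by field; rewrite !gt_eqF.
  set u := n%:R * T2 / a n ^+ 2.
  have u0 : 0 < u by rewrite divr_gt0// mulr_gt0.
  have x0 : 0 <= eps ^+ 2 / u / (40 * 40).
    by apply: divr_ge0; [apply: divr_ge0; [exact: sqr_ge0|exact: ltW]|exact: mulr_ge0].
  pose k := Num.truncn (eps ^+ 2 / u / (40 * 40)).
  have k1 : k%:R <= eps ^+ 2 / u / (40 * 40) by rewrite truncn_le.
  have k2 : eps ^+ 2 / u / (40 * 40) <= k.+1%:R by apply/ltW; exact: truncnS_gt.
  set Q := EV P (fun x => Y 0%N x ^+ 4).
  have [kQ|kQ] := leP (2 * k.+1%:R * Q) (n%:R * T2 ^+ 2).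
    (* 60^2 = 3600 exceeds 2 * 40 * 40 = 3200, as the condition on [L] demands. *)
    have L0 : 0 < 100 * 60 :> R by exact: mulr_gt0.
    have L2 : 2 * 100 ^+ 2 * (40 * 40) <= (100 * 60) ^+ 2 :> R.
      rewrite exprMn [leLHS](_ : _ = 100 ^+ 2 * (2 * (40 * 40))); last by ring.
      by rewrite ler_wpM2l ?sqr_ge0//; lra.
    have h := exp_le_sum_tail iY Yb an e0 n0 L0 L2 mu0 T20 k1 k2 kQ.
    apply: (le_trans h); apply: (@le_trans _ _ (40 * 40 * (Pr P S + n%:R * tail X b))); last by rewrite lerDl.
    apply: ler_wpM2l; first exact: mulr_ge0.
    apply: Pr_le_trunc => //.
      by apply: measurable_set_le => //; apply: measurable_sum => i; exact: measurable_funPT.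
    move=> w /= /YS h1 h2; rewrite /S /= /partial_sum.
    rewrite (eq_bigr (fun i : 'I_n => trX X b i w))// => i _ /=; rewrite trunc_id//; exact: h2.
  have Qb : Q <= eps * a n * third X b.
    rewrite /third -/b -EV_scale; last by apply: bm_exp; apply: bm_norm; exact: bm_trX.
    apply: EV_le; [bmt|apply: bm_scale; apply: bm_exp; apply: bm_norm; exact: bm_trX|] => x.
    rewrite -YE -[Y 0%N x ^+ 4](@ger0_norm _ _) ?exprn_even_ge0// normrX exprS.
    by rewrite ler_wpM2r// exprn_ge0.
  have h := exp_le_third an e0 n0 th1 T20 Qb k1 kQ (third_ge0 X b).
  by apply: (le_trans h); rewrite lerDr.
have iY : iid (trX X b) by exact: iid_trX.
have Yb := trX_le X b0.
have [m0|m0] := leP 0 (EV P (trX X b 0%N)).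
  by apply: (core _ iY Yb) => // w h; exact: (le_trans h (ler_norm _)).
have mo : measurable_fun setT (fun v : R => - v) by exact: oppr_measurable.
apply: (core (compRV (trX X b) mo)).
- exact: iid_comp.
- by move=> i x; rewrite /= normrN; exact: Yb.
- by congr EV; apply/funext => x; rewrite /= sqrrN.
- by move=> x; rewrite /= normrN.
- by rewrite (_ : EV P _ = - EV P (trX X b 0%N)) ?oppr_ge0 ?ltW// -EV_opp//; exact: bm_trX.
- by move=> w; rewrite /= sumrN => h; apply: (le_trans h); rewrite -normrN ler_norm.
Qed.

(** If some |S_n - X_i| >= t with probability above 3/4, then P(|S_n| >= t/2) > 5/8. Otherwise each
    large X_i meets a small remainder with conditional probability at least 1/4, and large summands
    are counted up to second order: mp/4 - (mp)^2/2. Using only m summands with mp <= 1/4 keeps the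
    correction below half of the main term. *)
Lemma tail_min_le (t : R) n : (0 < n)%N -> 0 < t -> tail X (t / 2) <= 8^-1 ->
  Num.min (n%:R * tail X (2 * t)) 1 <= 64 * Pr P [set w | t / 2 <= `|partial_sum X n w|].
Proof.
move=> n0 t0 p8; set p := tail X (2 * t).
have p0 : 0 <= p by exact: tail_ge0.
have pp8 : p <= 8^-1 by apply: le_trans p8; apply: le_tail; lra.
have mS : measurable_fun setT (partial_sum X n) by exact: mSn.
have mSt c : measurable [set w | c <= `|partial_sum X n w|] by exact: measurable_norm_ge.
have mSi i : measurable_fun setT (fun w => partial_sum X n w - X i w).
  by apply: measurable_funB => //; exact: mXi.
pose A i := [set w | 2 * t <= `|X i w|].
pose D i := [set w | `|partial_sum X n w - X i w| < t].
have mA i : measurable (A i) by exact: mXge.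
have mD i : measurable (D i) by exact: measurable_norm_lt.
have min1 : Num.min (n%:R * p) 1 <= 1 by rewrite ge_min lexx orbT.
have [[i Di]|nD] := pselect (exists i : 'I_n, Pr P (D i) < 4^-1).
  have h1 : Pr P (~` D i) = 1 - Pr P (D i) by exact: Pr_setC.
  have h2 : Pr P (~` D i) <= Pr P [set w | t / 2 <= `|partial_sum X n w|] + tail X (t / 2).
    rewrite -(tailE iidX i); apply: le_trans (Pr_setU P (mSt _) (mXge X i _)).
    apply: le_Pr; [exact: measurableC|by apply: measurableU => //; exact: mXge|].
    move=> w; rewrite /D /= => /negP; rewrite -leNgt => h.
    have [h'|h'] := leP (t / 2) `|X i w|; [by right|left => /=].
    have := ler_normB (partial_sum X n w) (X i w); lra.
  by apply: (le_trans min1); lra.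
have {}nD (i : 'I_n) : 4^-1 <= Pr P (D i) by rewrite leNgt; apply/negP => h; apply: nD; exists i.
have EA i : Pr P (A i) = p by exact: tailE.
have EAD (i : 'I_n) : p * 4^-1 <= Pr P (A i `&` D i).
  have iin : (i : nat) \in iota 0 n by rewrite mem_iota /= add0n.
  have pe := perm_to_rem iin.
  have us : uniq (nat_of_ord i :: rem (i : nat) (iota 0 n)) by rewrite -(perm_uniq pe) iota_uniq.
  have ind := indep_sum_cons iidX.1 us.
  have E : (fun w => \sum_(j <- rem (i : nat) (iota 0 n)) X j w) = (fun w => partial_sum X n w - X i w).
    apply/funext => w; rewrite /partial_sum -(big_mkord xpredT (fun j => X j w)) /index_iota subn0.
    by rewrite (perm_big _ pe) big_cons /=; ring.
  rewrite E in ind.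
  have mB1 : measurable [set v : R | 2 * t <= `|v|] by apply: measurable_norm_ge; exact: measurable_id.
  have mB2 : measurable [set v : R | `|v| < t] by apply: measurable_norm_lt; exact: measurable_id.
  have EE : Pr P (A i `&` D i) = Pr P (A i) * Pr P (D i).
    apply: EFin_inj; rewrite EFinM -!PrE//; last exact: measurableI.
    exact: (ind _ _ mB1 mB2).
  by rewrite EE EA ler_wpM2l.
have EAA (i j : nat) : i != j -> Pr P (A i `&` A j) = p ^+ 2.
  move=> ij; have us : uniq [:: i; j] by rewrite /= inE ij.
  have ind := indep_sum_cons iidX.1 us.
  have mB1 : measurable [set v : R | 2 * t <= `|v|] by apply: measurable_norm_ge; exact: measurable_id.
  have E1 : (fun x => \sum_(k <- [:: j]) X k x) = X j by apply/funext => w; rewrite big_seq1.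
  rewrite E1 in ind; have h := ind _ _ mB1 mB1.
  by apply: EFin_inj; rewrite expr2 -{1}(EA i) -(EA j) EFinM -!PrE//; exact: measurableI.
have bA i := bm_indic (R := R) (mA i).
have bAD i := bm_indic (R := R) (measurableI _ _ (mA i) (mD i)).
pose r m w : R := \sum_(i < m) \1_(A i) w.
have br m : bm (r m) by apply: bm_sum => i.
have Er m : EV P (r m) = m%:R * p.
  rewrite EV_sum//; under eq_bigr do rewrite EV_indic// EA.
  by rewrite sumr_const card_ord mulr_natl.
have Er2 m : EV P (fun w => r m w ^+ 2) <= m%:R * p + m%:R ^+ 2 * p ^+ 2.
  have bm2 (i : 'I_m) : bm (fun w => \sum_(j < m) \1_(A i `&` A j) w : R).
    by apply: bm_sum => j; apply: bm_indic; exact: measurableI.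
  rewrite (_ : (fun w => r m w ^+ 2) = (fun w => \sum_(i < m) \sum_(j < m) \1_(A i `&` A j) w)); last first.
    apply/funext => w; rewrite expr2 /r mulr_suml; apply: eq_bigr => i _.
    by rewrite mulr_sumr; apply: eq_bigr => j _; rewrite indicI.
  rewrite EV_sum//; apply: (@le_trans _ _ (\sum_(i < m) (p + m%:R * p ^+ 2))).
    apply: ler_sum => i _; rewrite EV_sum; last by move=> j; apply: bm_indic; exact: measurableI.
    rewrite (bigD1 i)//= EV_indic; last exact: measurableI.
    rewrite setIid EA lerD2l; apply: (@le_trans _ _ (\sum_(j < m) p ^+ 2)); last first.
      by rewrite sumr_const card_ord mulr_natl.
    rewrite [leRHS](bigD1 i)//=; apply: (@le_trans _ _ (\sum_(j < m | j != i) p ^+ 2)).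
      apply: ler_sum => j ji; rewrite EV_indic; last exact: measurableI.
      by rewrite EAA// eq_sym.
    by rewrite lerDr sqr_ge0.
  by rewrite sumr_const card_ord -mulr_natl; lra.
have rnat m w : exists k : nat, r m w = k%:R.
  exists (\sum_(i < m) (w \in A i))%N; rewrite /r natr_sum; apply: eq_bigr => i _.
  by rewrite indicE.
(* An integer r satisfies r - r (r - 1) / 2 <= 1; the events A i `&` D i force |S_n| >= t. *)
have key m : (m <= n)%N -> m%:R * p * 4^-1 - 2^-1 * (m%:R ^+ 2 * p ^+ 2) <=
    Pr P [set w | t / 2 <= `|partial_sum X n w|].
  move=> mn; apply: (@le_trans _ _ (EV P (fun w =>
     \sum_(i < m) \1_(A i `&` D i) w - 2^-1 * (r m w ^+ 2 - r m w)))).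
    have bS : bm (fun w => \sum_(i < m) \1_(A i `&` D i) w : R) by apply: bm_sum => i.
    have brm := br m.
    rewrite EV_sub; [|bmt|bmt].
    rewrite EV_scale; last bmt.
    rewrite EV_sub; [|bmt|bmt].
    rewrite Er EV_sum//.
    have : m%:R * p * 4^-1 <= \sum_(i < m) EV P (\1_(A i `&` D i)).
      rewrite -mulrA mulr_natl -[X in _ *+ X]card_ord -sumr_const.
      apply: ler_sum => i _; rewrite EV_indic; last exact: measurableI.
      exact: (EAD (widen_ord mn i)).
    by have := Er2 m; lra.
  rewrite -EV_indic//; apply: EV_le.
  - have bS : bm (fun w => \sum_(i < m) \1_(A i `&` D i) w : R) by apply: bm_sum => i.
    by have brm := br m; bmt.
  - exact: bm_indic.
  move=> w; have [k rk] := rnat m w.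
  have kk : (0 <= (k%:R - 1) * (k%:R - 2) :> R) /\ (0 <= k%:R ^+ 2 - k%:R :> R).
    case: k {rk} => [|[|k]]; first by split; lra.
      by split; lra.
    have -> : k.+2%:R = k%:R + 2 :> R by rewrite -addn2 natrD.
    have : 0 <= k%:R :> R by []. by split; nra.
  rewrite [leRHS]indicE; have [wS|wS] := boolP (w \in _).
    have : \sum_(i < m) \1_(A i `&` D i) w <= r m w :> R.
      apply: ler_sum => i _; rewrite indicI /= !indicE.
      by case: (w \in A i); case: (w \in D i); rewrite /= ?mulr1 ?mulr0.
    by rewrite rk /=; nra.
  rewrite big1 ?rk => [|i _]; first by case: kk => _ kk; rewrite /= mulr0n; lra.
  rewrite indicE memNset// => -[]; rewrite /A /D /= => h1 h2.
  move: wS; rewrite notin_setE; apply => /=.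
  have := lerB_dist (X i w) (X i w - partial_sum X n w).
  by rewrite opprB addrCA subrr addr0 distrC; lra.
have [np|np] := leP (n%:R * p) 4^-1.
  have := key n (leqnn _); rewrite -exprMn.
  have z0 : 0 <= n%:R * p by rewrite mulr_ge0.
  have : Num.min (n%:R * p) 1 <= n%:R * p by rewrite ge_min lexx.
  move: (n%:R * p) z0 np => z z0 np; rewrite expr2; nra.
have pp : 0 < p by rewrite lt_def p0 andbT; apply: contraTneq np => ->; rewrite mulr0 -leNgt.
have p4 : 0 < 4 * p by exact: mulr_gt0.
(* Rounding down costs at most p <= 1/8, so mp stays in [1/8, 1/4] and the bound mp/8 is at least
   1/64. *)
pose m := Num.truncn (4 * p)^-1.
have m1 : m%:R * p <= 4^-1.
  have : m%:R <= (4 * p)^-1 by rewrite truncn_le// invr_ge0 ltW.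
  by rewrite -[X in _ <= X]mul1r ler_pdivlMr//; lra.
have m2 : 4^-1 < m.+1%:R * p.
  have : (4 * p)^-1 < m.+1%:R by exact: truncnS_gt.
  by rewrite -[X in X < _]mul1r ltr_pdivrMr//; lra.
have mn : (m <= n)%N.
  by rewrite ltnW// -(ltr_nat R) -(ltr_pM2r pp); exact: le_lt_trans np.
apply: (le_trans min1); have := key m mn; rewrite -exprMn.
have mS1 : m.+1%:R = m%:R + 1 :> R by rewrite -addn1 natrD.
have : 8^-1 <= m%:R * p by move: m2; rewrite mS1; lra.
by move: (m%:R * p) m1 => z z1 z2; rewrite expr2; nra.
Qed.

End lower_estimates.

(** * Medians *)

Section medians_and_tails.
Context {d : measure_display} {T : measurableType d} {R : realType}
  (P : probability T R).

Lemma cdf_ge_of_right (Y : {RV P >-> R}) (m : R) (c : \bar R) :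
  (forall x, m < x -> (c <= cdf Y x)%E) -> (c <= cdf Y m)%E.
Proof.
move=> h; have H := @cdf_right_continuous _ _ _ P Y m.
apply: (cvge_ge _ H); by near=> x; apply: h; near: x; exact: nbhs_right_gt.
Unshelve. all: by end_near. Qed.

Lemma tail_small (f : T -> R) (e : R) : measurable_fun setT f -> 0 < e ->
  exists c, Pr P [set w | c <= `|f w|] <= e.
Proof.
move=> mf e0.
have mn : measurable_fun setT (fun x => `|f x|) by apply: measurableT_comp => //.
pose Y := mkRV P mn.
have := @cvg_ccdfy0 _ _ _ P Y.
move=> /fine_cvgP[_] /cvgrPdist_lt /(_ e e0) [M [_ hM]].
exists (M + 2); have h : M < M + 1 by rewrite ltrDl.
have := hM _ h; rewrite /= sub0r normrN; move=> h1.
have := le_lt_trans (ler_norm _) h1 => {h1}h1; apply/ltW; apply: le_lt_trans h1.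
rewrite /Pr; apply: fine_le.
- by rewrite fin_num_measure//; exact: measurable_norm_ge.
- by rewrite fin_num_measure.
- apply: le_measure; rewrite ?inE; first exact: measurable_norm_ge.
    by rewrite -[X in measurable X]setTI; exact: (@measurable_funPT _ _ _ _ Y).
  by move=> w /= h2; rewrite in_itv /= andbT; apply: lt_le_trans h2; lra.
Qed.

(** The median is m = inf {r : P(f <= r) >= 1/2}. Right continuity of the distribution function of f
    at m gives one inequality, that of -f at -m the other. *)
Lemma median_exists (f : T -> R) : measurable_fun setT f -> exists m, is_median P f m.
Proof.
move=> mf; pose Y := mkRV P mf.
have mo : measurable_fun setT (fun x => - f x) by exact: measurableT_comp.
pose Y' := mkRV P mo.
have cE r : cdf Y r = P [set w | f w <= r].
  by congr (P _); apply/seteqP; split=> w /=; rewrite in_itv.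
have cE' r : cdf Y' r = P [set w | - r <= f w].
  by congr (P _); apply/seteqP; split=> w /=; rewrite in_itv /= lerNl.
have mle r : measurable [set w | f w <= r] by exact: measurable_set_le.
have mge r : measurable [set w | r <= f w] by exact: measurable_set_le.
(* A tail below 1/2 makes the set of such r nonempty and bounded below. *)
have [c hc] := @tail_small f (1 / 4) mf ltac:(lra).
have mc : measurable [set w | c <= `|f w|] by exact: measurable_norm_ge.
pose A := [set r | ((1 / 2)%:E <= cdf Y r)%E].
have Ac : A c.
  rewrite /A /= cE PrE// lee_fin.
  have h := Pr_setC P (mle c).
  have : Pr P (~` [set w | f w <= c]) <= Pr P [set w | c <= `|f w|].
    apply: le_Pr => //; first exact: measurableC.
    by move=> w /= /negP; rewrite -ltNge => /ltW h'; rewrite (le_trans h')// ler_norm.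
  by move: hc; lra.
have lb r : A r -> - c <= r.
  rewrite /A /= cE PrE// lee_fin => h; rewrite leNgt; apply/negP => rc.
  have : Pr P [set w | f w <= r] <= Pr P [set w | c <= `|f w|].
    by apply: le_Pr => // w /= h'; rewrite ler_normr; apply/orP; right; lra.
  by move: hc; lra.
have hlb : has_lbound A by exists (- c) => r /lb.
have hinf : has_inf A by split => //; exists c.
exists (inf A); split.
- rewrite -[inf A]opprK -cE'; apply: cdf_ge_of_right => x hx.
  rewrite cE' PrE// lee_fin.
  have nA : ~ A (- x).
    by move=> /(ge_inf hlb); rewrite leNgt => /negP; apply; rewrite ltrNl.
  have : Pr P [set w | f w <= - x] < 1 / 2.
    by rewrite ltNge; apply/negP => h; apply: nA; rewrite /A /= cE PrE// lee_fin.
  have h := Pr_setC P (mle (- x)).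
  have : Pr P (~` [set w | f w <= - x]) <= Pr P [set w | - x <= f w].
    by apply: le_Pr => //; [exact: measurableC|move=> w /= /negP; rewrite -ltNge => /ltW].
  by lra.
- rewrite -cE; apply: cdf_ge_of_right => x hx.
  have e0 : 0 < x - inf A by rewrite subr_gt0.
  have [r Ar rx] := inf_adherent e0 hinf.
  rewrite addrC subrK in rx.
  by apply: (le_trans Ar); apply: cdf_nondecreasing; exact: ltW.
Qed.

End medians_and_tails.

(** * Series criteria *)

Lemma limn_einf_gt0 {R : realType} (u : (\bar R)^nat) : (0 < limn_einf u)%E ->
  exists2 c : R, 0 < c & exists n0, forall n, (n0 <= n)%N -> (c%:E <= u n)%E.
Proof.
rewrite limn_einf_lim => h.
have [n0 hn0] : exists n0, (0 < einfs u n0)%E.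
  apply: contrapT => /forallNP hN; move: h; rewrite ltNge => /negP; apply.
  apply: lime_le; first exact: is_cvg_einfs.
  by apply: nearW => n; rewrite leNgt; apply/negP; exact: hN.
(* The infimum may be +oo; the minimum with 1 is a finite constant. *)
pose e := Order.min (einfs u n0) 1%E.
have e0 : (0 < e)%E by rewrite /e lt_min hn0 lte01.
have e1 : (e <= 1)%E by rewrite /e ge_min lexx orbT.
have ef : e \is a fin_num.
  by rewrite ge0_fin_numE ?(ltW e0)// (le_lt_trans e1)// ltry.
exists (fine e); first by rewrite fine_gt0// e0 (le_lt_trans e1)// ltry.
exists n0 => n nn; rewrite fineK//; apply: (@le_trans _ _ (einfs u n0)).
  by rewrite /e ge_min lexx.
by apply: ereal_inf_lbound; exists n.
Qed.

Section series_criteria.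
Context {d : measure_display} {T : measurableType d} {R : realType}
  (P : probability T R) (X : nat -> {RV P >-> R}) (tau a : nat -> R) (theta : R).
Hypotheses (iidX : iid X) (tau0 : forall n, (1 <= n)%N -> 0 <= tau n)
  (a0 : forall n, (1 <= n)%N -> 0 < a n)
  (aI : forall n m, (1 <= n)%N -> (n <= m)%N -> a n <= a m)
  (th1 : 1 <= theta).

Let nonneg_tail eps n : (1 <= n)%N -> 0 <= n%:R * tau n * tail X (eps * a n).
Proof. by move=> n1; apply: mulr_ge0; [apply: mulr_ge0 => //; exact: tau0|exact: tail_ge0]. Qed.

Lemma exp_term_ge0 eps n : 0 <= exp_term X a eps n.
Proof. by rewrite /exp_term; case: ifP => // _; exact: expR_ge0. Qed.

Hypothesis moment_bsum : forall eps, 0 < eps ->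
  bsum (fun n => n%:R * tau n * tail X (eps * a n)) ->
  bsum (fun n => tau n * (n%:R * third X (eps * a n) / a n ^+ 3) `^ theta).

Lemma star_sufficient (mu : nat -> R) :
  (forall n, (1 <= n)%N -> is_median P (partial_sum X n) (mu n)) ->
  (forall eps, 0 < eps -> bsum (fun n => if eps * a n < `|mu n| then tau n else 0)) ->
  (forall eps, 0 < eps -> bsum (fun n => n%:R * tau n * tail X (eps * a n))) ->
  (forall eps, 0 < eps -> bsum (fun n => tau n * exp_term X a eps n)) ->
  forall eps, 0 < eps ->
    bsum (fun n => tau n * Pr P [set w | eps * a n <= `|partial_sum X n w|]).
Proof.
move=> med ci cii ciii e e0.
have c0 : 0 < 8 * theta + 1 by have := th1; lra.
pose eps := e / (8 * theta + 1); have eps0 : 0 < eps by exact: divr_gt0.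
have K0 : 0 <= 4 * expR (27 * 27) :> R by rewrite mulr_ge0 ?expR_ge0.
have pw0 : 0 <= ((eps ^+ 3)^-1) `^ theta by exact: powR_ge0.
have b1 := ci _ eps0.
have b2 := bsum_scale K0 (ciii _ eps0).
have b3 := bsum_scale (mulr_ge0 K0 pw0) (moment_bsum eps0 (cii _ eps0)).
have b4 := bsum_scale (ler0n R 2) (cii _ eps0).
have rest0 n : (1 <= n)%N -> 0 <= 4 * expR (27 * 27) * (tau n * exp_term X a eps n) +
    (4 * expR (27 * 27) * ((eps ^+ 3)^-1) `^ theta *
    (tau n * (n%:R * third X (eps * a n) / a n ^+ 3) `^ theta) +
    2 * (n%:R * tau n * tail X (eps * a n))).
  move=> n1; have t0 := tau0 n1; apply: addr_ge0.
    by apply: mulr_ge0 => //; apply: mulr_ge0 => //; exact: exp_term_ge0.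
  apply: addr_ge0.
    by apply: mulr_ge0; [exact: mulr_ge0|apply: mulr_ge0 => //; exact: powR_ge0].
  by apply: mulr_ge0 => //; exact: nonneg_tail.
apply: (bsum_le (n0 := 0) _ _ (bsum_add b1 (bsum_add b2 (bsum_add b3 b4)))).
  by move=> n n1; apply: addr_ge0; [case: ifP => // _; exact: tau0|exact: rest0].
move=> n n1 _; have t0 := tau0 n1; have an := a0 n1.
(* Where the median is large the probability is bounded by 1, and condition (i) sums the weights. *)
case: ifPn => h.
  have : Pr P [set w | e * a n <= `|partial_sum X n w|] <= 1.
    by apply: Pr_le1; exact: measurable_norm_ge (mSn _ _).
  by move=> /(ler_wpM2l t0); have := rest0 n n1; lra.
rewrite -leNgt in h.
have := sum_tail_le iidX eps0 an th1 n1 (med _ n1) h.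
have -> : (8 * theta + 1) * (eps * a n) = e * a n.
  by rewrite /eps mulrA [_ * (e / _)]mulrC divfK// gt_eqF.
move=> /(ler_wpM2l t0) H; apply: (le_trans H).
have a3 : 0 < a n ^+ 3 by rewrite exprn_gt0.
have e3 : 0 < eps ^+ 3 by rewrite exprn_gt0.
have q0 : 0 <= n%:R * third X (eps * a n) / a n ^+ 3.
  by apply: divr_ge0; [apply: mulr_ge0 => //; exact: third_ge0|exact: ltW].
have -> : n%:R * third X (eps * a n) / (eps * a n) ^+ 3 =
    (eps ^+ 3)^-1 * (n%:R * third X (eps * a n) / a n ^+ 3).
  by field; rewrite !gt_eqF.
have e3i : 0 <= (eps ^+ 3)^-1 by rewrite invr_ge0 ltW.
rewrite (powRM _ e3i q0); lra.
Qed.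

Hypothesis ay : a @ \oo --> +oo.
Hypothesis star : forall eps, 0 < eps ->
  bsum (fun n => tau n * Pr P [set w | eps * a n <= `|partial_sum X n w|]).

(** If |mu_n| > eps a_n, one of the half-lines bounded by mu_n lies in the region |s| >= eps a_n,
    which therefore has probability at least 1/2. *)
Lemma median_condition (mu : nat -> R) :
  (forall n, (1 <= n)%N -> is_median P (partial_sum X n) (mu n)) ->
  forall eps, 0 < eps -> bsum (fun n => if eps * a n < `|mu n| then tau n else 0).
Proof.
move=> med eps e0; have b := bsum_scale (ler0n R 2) (star e0).
apply: (bsum_le (n0 := 0) _ _ b) => n n1.
  by apply: mulr_ge0 => //; apply: mulr_ge0; [exact: tau0|exact: Pr_ge0].
move=> _; case: ifPn => h; last by apply: mulr_ge0 => //; apply: mulr_ge0; [exact: tau0|exact: Pr_ge0].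
have mS : measurable_fun setT (partial_sum X n) by exact: mSn.
have mA : measurable [set w | eps * a n <= `|partial_sum X n w|] by exact: measurable_norm_ge.
have [] := med n n1; rewrite !PrE; [|exact: measurable_set_le..].
rewrite !lee_fin => m1 m2.
have : 1 / 2 <= Pr P [set w | eps * a n <= `|partial_sum X n w|].
  move: h; rewrite ltr_normr => /orP[h|h].
    apply: (le_trans m1); apply: le_Pr => //; first exact: measurable_set_le.
    by move=> w /= h'; rewrite ler_normr; apply/orP; left; lra.
  apply: (le_trans m2); apply: le_Pr => //; first exact: measurable_set_le.
  by move=> w /= h'; rewrite ler_normr; apply/orP; right; lra.
by move=> /(ler_wpM2l (tau0 n1)); lra.
Qed.

Lemma tail_condition : conditionA tau ->
  forall eps, 0 < eps -> bsum (fun n => n%:R * tau n * tail X (eps * a n)).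
Proof.
move=> cA eps e0; have e4 : 0 < eps / 4 by rewrite divr_gt0.
have b := bsum_scale (ler0n R 64) (star e4).
have [c hc] := @tail_small _ _ _ P (X 0%N) 8^-1 (mXi X 0) ltac:(lra).
(* Divergence of a_n makes the tail at eps a_n/4 at most 1/8 eventually. This is the level t/2 of
   [tail_min_le] for t = eps a_n/2, and 2t is eps a_n. *)
have [n0 hn0] : exists n0, forall n, (n0 <= n)%N -> c <= eps / 4 * a n.
  move/cvgryPge : ay => /(_ (c / (eps / 4))) [n0 _ h]; exists n0 => n nn.
  by have := h n nn; rewrite /= ler_pdivrMr// mulrC.
have s1 : bsum (fun n => tau n * Num.min (n%:R * tail X (eps * a n)) 1).
  apply: (bsum_le (n0 := n0) _ _ b) => n n1.
    by apply: mulr_ge0 => //; apply: mulr_ge0; [exact: tau0|exact: Pr_ge0].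
  move=> nn; have an := a0 n1.
  have t0 : 0 < eps * a n / 2 by rewrite divr_gt0// mulr_gt0.
  have e1 : 2 * (eps * a n / 2) = eps * a n by field.
  have e2 : eps * a n / 2 / 2 = eps / 4 * a n by field.
  have := tail_min_le iidX n1 t0; rewrite e1 e2 => h.
  have {}h := h (le_trans (le_tail X (hn0 n nn)) hc).
  by have := ler_wpM2l (tau0 n1) h; lra.
have t0 n : (1 <= n)%N -> 0 <= tail X (eps * a n) by move=> _; exact: tail_ge0.
have tI n : (1 <= n)%N -> tail X (eps * a n.+1) <= tail X (eps * a n).
  by move=> n1; apply: le_tail; rewrite ler_pM2l//; exact: aI.
have mn n : (1 <= n)%N -> 0 <= tau n * Num.min (n%:R * tail X (eps * a n)) 1.
  move=> n1; apply: mulr_ge0; first exact: tau0.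
  by rewrite le_min ler01 andbT mulr_ge0// t0.
have mn' n : (1 <= n)%N -> 0 <= tau n * (n%:R * tail X (eps * a n)).
  by move=> n1; apply: mulr_ge0; [exact: tau0|apply: mulr_ge0 => //; exact: t0].
have /(bsumP mn') := cA _ t0 tI ((bsumP mn).2 s1).
by apply: (bsum_le (n0 := 0) mn') => n _ _; rewrite [n%:R * tau n]mulrC mulrA.
Qed.

Lemma exp_condition :
  (forall eps, 0 < eps -> bsum (fun n => n%:R * tau n * tail X (eps * a n))) ->
  forall eps, 0 < eps -> bsum (fun n => tau n * exp_term X a eps n).
Proof.
move=> cii eps e0.
have l0 : 0 < eps / (100 * 60) by apply: divr_gt0 => //; exact: mulr_gt0.
pose K := ((1 + 3 * theta / eps ^+ 2) ^+ 3 * (2 * eps * (eps ^+ 2 / (40 * 40) + 1))) `^ theta.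
have K0 : 0 <= K by exact: powR_ge0.
have q0 : 0 <= 40 * 40 :> R by exact: mulr_ge0.
have b1 := bsum_scale q0 (bsum_add (star l0) (cii _ e0)).
have b2 := bsum_scale K0 (moment_bsum e0 (cii _ e0)).
apply: (bsum_le (n0 := 0) _ _ (bsum_add b1 b2)) => n n1.
  apply: addr_ge0; apply: mulr_ge0 => //.
    by apply: addr_ge0; [apply: mulr_ge0; [exact: tau0|exact: Pr_ge0]|exact: nonneg_tail].
  by apply: mulr_ge0; [exact: tau0|exact: powR_ge0].
move=> _; have := ler_wpM2l (tau0 n1) (exp_term_le iidX e0 (a0 n1) th1 n1).
by rewrite -/K; lra.
Qed.

End series_criteria.

Unset Implicit Arguments.

Theorem theorem1 (d : measure_display) (T : measurableType d) (R : realType)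
  (P : probability T R) (X : nat -> {RV P >-> R})
  (tau a : nat -> R) (theta C N : R) :
  iid X ->
  (forall n, (1 <= n)%N -> 0 <= tau n) ->
  (forall n, (1 <= n)%N -> 0 < a n) ->
  (forall n m, (1 <= n)%N -> (n <= m)%N -> a n <= a m) ->
  a @ \oo --> +oo ->
  1 <= theta -> 0 < C -> 2 <= N ->
  (forall n : nat, N <= n%:R ->
     ((a n `^ (3 * theta) / n%:R `^ (theta - 1))%:E *
       \sum_(n <= k <oo) (k%:R `^ theta * tau k / a k `^ (3 * theta))%:E
     <= (C * \sum_(1 <= k < n) k%:R * tau k)%:E)%E) ->
  (1 < theta ->
     (0 < limn_einf (fun n => ereal_inf
        [set ((a k ^+ 3 / (k%:R * a n ^+ 3)) *
              \sum_(1 <= j < n) j%:R * tau j)%:E | k in [set k | (n <= k)%N]]))%E) ->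
  let cond_i := exists mu : nat -> R,
      (forall n, (1 <= n)%N -> is_median P (partial_sum X n) (mu n)) /\
      (forall eps : R, 0 < eps ->
        (\sum_(1 <= n <oo | (eps * a n < `|mu n|)%R) (tau n)%:E < +oo)%E) in
  let cond_ii := forall eps : R, 0 < eps ->
      (\sum_(1 <= n <oo)
         (n%:R * tau n)%:E * P [set w | (eps * a n <= `|X 0%N w|)%R] < +oo)%E in
  let cond_iii := forall eps : R, 0 < eps ->
      (\sum_(1 <= n <oo) (tau n * exp_term X a eps n)%:E < +oo)%E in
  let star := forall eps : R, 0 < eps ->
      (\sum_(1 <= n <oo)
         (tau n)%:E * P [set w | (eps * a n <= `|partial_sum X n w|)%R] < +oo)%E in
  ((cond_i /\ cond_ii /\ cond_iii) -> star) /\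
  (conditionA tau -> star -> cond_i /\ cond_ii /\ cond_iii).
Proof.
move=> iidX tau0 a0 aI ay th1 C0 N2 hC hlim ci cii ciii star.
have t0 eps n : (1 <= n)%N -> 0 <= n%:R * tau n * tail X (eps * a n).
  by move=> n1; apply: mulr_ge0; [apply: mulr_ge0 => //; exact: tau0|exact: tail_ge0].
have hC' n M : (1 <= n)%N -> N <= n%:R ->
    (a n `^ (3 * theta) / n%:R `^ (theta - 1)) *
    \sum_(n <= k < M) (k%:R `^ theta * tau k / a k `^ (3 * theta)) <=
    C * \sum_(1 <= j < n) j%:R * tau j.
  move=> n1 Nn; rewrite -lee_fin EFinM; apply: le_trans (hC n Nn).
  apply: lee_wpmul2l; first by rewrite lee_fin divr_ge0// powR_ge0.
  rewrite -sumEFin; apply: nneseries_lim_ge => k nk _.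
  rewrite lee_fin; apply: mulr_ge0; last by rewrite invr_ge0 powR_ge0.
  by apply: mulr_ge0; [exact: powR_ge0|apply: tau0; exact: leq_trans nk].
have hlim' : 1 < theta -> exists2 c : R, 0 < c & exists n0, forall n k : nat,
    (n0 <= n)%N -> (1 <= n)%N -> (n <= k)%N ->
    c <= a k ^+ 3 / (k%:R * a n ^+ 3) * \sum_(1 <= j < n) j%:R * tau j.
  move=> /hlim /limn_einf_gt0 [c c0 [n0 h]]; exists c => //; exists n0 => n k nn n1 nk.
  rewrite -lee_fin; apply: (le_trans (h n nn)); apply: ereal_inf_lbound.
  by exists k.
(* beta and p are the third moment and the tail at level eps a_n; [D] = eps^3 comes from the cube of
   that level in [third_sub_le]. *)
have mom eps : 0 < eps -> bsum (fun n => n%:R * tau n * tail X (eps * a n)) ->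
    bsum (fun n => tau n * (n%:R * third X (eps * a n) / a n ^+ 3) `^ theta).
  move=> e0 s.
  have le_a n : (1 <= n)%N -> eps * a n <= eps * a n.+1.
    by move=> n1; rewrite ler_pM2l//; exact: aI.
  apply: (moment_series_bounded tau0 a0 th1 C0 hC' hlim' (beta := fun n => third X (eps * a n))
    (p := fun n => tail X (eps * a n)) (D := eps ^+ 3)) => //.
  - by move=> n _; exact: third_ge0.
  - by move=> n n1; apply: le_third; [rewrite mulr_gt0// a0|exact: le_a].
  - by move=> n _; exact: tail_ge0.
  - by move=> n n1; apply: le_tail; exact: le_a.
  - by rewrite exprn_ge0// ltW.
  - move=> n n1; rewrite -exprMn; apply: third_sub_le; last exact: le_a.
    by rewrite mulr_gt0// a0.
have ciE mu eps : ((\sum_(1 <= n <oo | (eps * a n < `|mu n|)%R) (tau n)%:E < +oo)%E <->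
    bsum (fun n => if eps * a n < `|mu n| then tau n else 0)).
  have -> : (\sum_(1 <= n <oo | (eps * a n < `|mu n|)%R) (tau n)%:E)%E =
      (\sum_(1 <= n <oo) (if eps * a n < `|mu n| then tau n else 0)%:E)%E.
    by rewrite eseries_mkcond; apply: eq_eseriesr => n _; case: ifP.
  by apply: bsumP => n n1; case: ifP => // _; exact: tau0.
have ciiE eps : ((\sum_(1 <= n <oo)
    (n%:R * tau n)%:E * P [set w | (eps * a n <= `|X 0%N w|)%R] < +oo)%E <->
    bsum (fun n => n%:R * tau n * tail X (eps * a n))).
  have -> : (\sum_(1 <= n <oo) (n%:R * tau n)%:E * P [set w | (eps * a n <= `|X 0%N w|)%R])%E =
      (\sum_(1 <= n <oo) (n%:R * tau n * tail X (eps * a n))%:E)%E.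
    by apply: eq_eseriesr => n _; rewrite EFinM PrE//; exact: mXge.
  by apply: bsumP => n; exact: t0.
have ciiiE eps : ((\sum_(1 <= n <oo) (tau n * exp_term X a eps n)%:E < +oo)%E <->
    bsum (fun n => tau n * exp_term X a eps n)).
  by apply: bsumP => n n1; apply: mulr_ge0; [exact: tau0|exact: exp_term_ge0].
have starE eps : ((\sum_(1 <= n <oo)
    (tau n)%:E * P [set w | (eps * a n <= `|partial_sum X n w|)%R] < +oo)%E <->
    bsum (fun n => tau n * Pr P [set w | eps * a n <= `|partial_sum X n w|])).
  have -> : (\sum_(1 <= n <oo) (tau n)%:E * P [set w | (eps * a n <= `|partial_sum X n w|)%R])%E =
      (\sum_(1 <= n <oo) (tau n * Pr P [set w | eps * a n <= `|partial_sum X n w|])%:E)%E.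
    by apply: eq_eseriesr => n _; rewrite EFinM PrE//; exact: measurable_norm_ge (mSn _ _).
  by apply: bsumP => n n1; apply: mulr_ge0; [exact: tau0|exact: Pr_ge0].
split=> [[[mu [med cmu]] [h2 h3]] eps e0|cA hs].
  apply/starE; apply: (star_sufficient iidX tau0 a0 th1 mom med) => // e e1.
  - exact/ciE/cmu.
  - exact/ciiE/h2.
  - exact/ciiiE/h3.
have hs' eps : 0 < eps -> bsum (fun n => tau n * Pr P [set w | eps * a n <= `|partial_sum X n w|]).
  by move=> e0; apply/starE/hs.
have h2 := tail_condition iidX tau0 a0 aI ay hs' cA.
split; [|split].
- have /choice [mu med] : forall n, exists m, is_median P (partial_sum X n) m.
    by move=> n; apply: median_exists; exact: mSn.
  have med' n : (1 <= n)%N -> is_median P (partial_sum X n) (mu n) by [].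
  by exists mu; split => // eps e0; apply/ciE/(median_condition tau0 hs' med').
- by move=> eps e0; apply/ciiE/h2.
- by move=> eps e0; apply/ciiiE/(exp_condition iidX tau0 a0 th1 mom hs' h2).
Qed.
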